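(* Let $d\geq 1$ and $t\geq 1$ be integers and let $r\geq 2$ be a prime. Then \[ M'(rt,r,d)\;\geq\;\Big\lceil \tfrac{td(r-1)+t}{r-1}-1 \Big\rceil . \] Moreover, this bound is optimal (i.e. holds with equality) for $M'(r,r,d)$ (the case $t=1$, where it reads $M'(r,r,d)=d$) and for $M'(n,2,1)$ (the case $r=2$, $d=1$, where it reads $M'(2t,2,1)=2t-1$).
   Context: All measures are probability measures on $\mathbb{R}^d$ absolutely continuous with respect to Lebesgue measure. A convex partition of $\mathbb{R}^d$ into $n$ parts is an ordered tuple $\mathcal{K}=(K_1,\dots,K_n)$ of closed convex sets with $K_1\cup\dots\cup K_n=\mathbb{R}^d$ and pairwise disjoint interiors (some $K_i$ may be empty). An $r$-labeled convex partition is a pair $(\mathcal{K},\ell)$ with $\ell\colon[n]\to[r]$ arbitrary, where $[n]=\{1,\dots,n\}$. Oriented hyperplanes: for a unit vector $v\in S^{d-1}$ and $a\in\mathbb{R}\cup\{-\infty,+\infty\}$, let $H^+_{(v,a)}=\{x:\langle x,v\rangle\ge a\}$ and $H^-_{(v,a)}=\{x:\langle x,v\rangle\le a\}$ for $a\in\mathbb{R}$; $H^+_{(v,+\infty)}=\emptyset$, $H^-_{(v,+\infty)}=\mathbb{R}^d$; $H^+_{(v,-\infty)}=\mathbb{R}^d$, $H^-_{(v,-\infty)}=\emptyset$. For $r$-labeled convex partitions $((K_1,\dots,K_n),\ell)$ and $((K'_1,\dots,K'_m),\ell')$ define $\mathcal{K}*_{(v,a)}\mathcal{K}'$ to be the $r$-labeled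 partition $((H^+_{(v,a)}\cap K_1,\dots,H^+_{(v,a)}\cap K_n,H^-_{(v,a)}\cap K'_1,\dots,H^-_{(v,a)}\cap K'_m),\ell'')$ where $\ell''(k)=\ell(k)$ for $k\le n$ and $\ell''(k)=\ell'(k-n)$ for $n<k\le n+m$. Power diagrams: for pairwise distinct affine functionals $a_1,\dots,a_r\colon\mathbb{R}^d\to\mathbb{R}$ let $K_i=\{x: a_i(x)=\max_j a_j(x)\}$; the $r$-labeled partition $((K_1,\dots,K_r),\mathrm{id}_{[r]})$ is a power diagram, and $\mathcal{X}_{1,r}$ is the space of all of these. A space of $t$-iterated $r$-labeled convex partitions is defined recursively: for $t=1$ it is $\mathcal{X}_{1,r}$; for $t\ge 2$ it is any set of the form $\{\mathcal{K}'*_{(v,a)}\mathcal{K}'':\mathcal{K}'\in\mathcal{X}',\mathcal{K}''\in\mathcal{X}'',a\in\mathbb{R}\cup\{\pm\infty\}\}$ where $v\in S^{d-1}$ is a fixed unit vector, $\mathcal{X}'$ is a space of $t'$-iterated and $\mathcal{X}''$ a space of $t''$-iterated $r$-labeled convex partitions, with $t'+t''=t$. Elements of such spaces have exactly $rt$ (possibly empty) parts and are called iterated $r$-labeled convex partitions. For $n$ a multiple of $r$, $M'(n,r,d)$ is the largest integer $M'$ such that for any $M'$ measures $\mu_1,\dots,\mu_{M'}$ on $\mathbb{R}^d$ there is an iterated $r$-labeled convex partition $((K_1,\dots,K_n),\ell)$ of $\mathbb{R}^d$ into $n$ parts with $\mu_j\big(\bigcup_{i\in\ell^{-1}(s)}K_i\big)=\tfrac1r$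 for all $1\le j\le M'$ and $1\le s\le r$. *)

(* Defs.v *)
From HB Require Import structures.
From mathcomp Require Import all_boot all_order all_algebra.
From mathcomp Require Import all_classical all_reals all_analysis.
From Stdlib Require List.
Set Implicit Arguments. Unset Strict Implicit. Unset Printing Implicit Defensive.
Import Order.TTheory GRing.Theory Num.Theory.
Local Open Scope classical_set_scope.
Local Open Scope ring_scope.

Section Defs.
Variable R : realType.
Variable d : nat.

(* Points of R^d are d-tuples of reals; measurable structure = product
   (= Borel) sigma-algebra of the library. *)
Definition pt := d.-tuple R.

Definition dotp (x y : pt) : R := \sum_(i < d) tnth x i * tnth y i.

Definition unit_vec (v : pt) : Prop := dotp v v = 1.

Definition Hplus (v : pt) (a : \bar R) : set pt := [set x | (a <= (dotp x v)%:E)%E].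
Definition Hminus (v : pt) (a : \bar R) : set pt := [set x | ((dotp x v)%:E <= a)%E].

Definition box (a b : pt) : set pt :=
  [set x | forall i, tnth a i <= tnth x i <= tnth b i].

Definition lebesgue_null (A : set pt) : Prop :=
  forall eps : R, 0 < eps -> exists a b : nat -> pt,
    (forall k i, tnth (a k) i <= tnth (b k) i) /\
    A `<=` \bigcup_k box (a k) (b k) /\
    (forall N, \sum_(k < N) \prod_(i < d) (tnth (b k) i - tnth (a k) i) <= eps).

Definition abs_cont (mu : set pt -> \bar R) : Prop :=
  forall A : set pt, measurable A -> lebesgue_null A -> mu A = 0%E.

Variable r : nat.

(* An r-labeled partition: ordered list of (part, label), labels in 'I_r
   (label set [r] = {1..r} shifted to {0..r-1}). *)
Definition lpart := seq (set pt * 'I_r).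

Definition affine_distinct (c : 'I_r -> pt) (b : 'I_r -> R) : Prop :=
  forall i j, i != j -> (fun x => dotp (c i) x + b i) <> (fun x => dotp (c j) x + b j).

Definition power_diagram (c : 'I_r -> pt) (b : 'I_r -> R) : lpart :=
  [seq ([set x | forall j, dotp (c j) x + b j <= dotp (c i) x + b i], i) | i <- enum 'I_r].

Definition star (v : pt) (a : \bar R) (P1 P2 : lpart) : lpart :=
  [seq (Hplus v a `&` p.1, p.2) | p <- P1] ++ [seq (Hminus v a `&` p.1, p.2) | p <- P2].

Inductive iterated : nat -> lpart -> Prop :=
| iterated_pd (c : 'I_r -> pt) (b : 'I_r -> R) :
    affine_distinct c b -> iterated 1 (power_diagram c b)
| iterated_star (t1 t2 : nat) (P1 P2 : lpart) (v : pt) (a : \bar R) :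
    iterated t1 P1 -> iterated t2 P2 -> unit_vec v ->
    iterated (t1 + t2) (star v a P1 P2).

Definition label_union (P : lpart) (s : 'I_r) : set pt :=
  [set x | exists2 p, List.In p P & p.2 = s /\ p.1 x].

End Defs.

Definition equipart_prop (R : realType) (d r n M : nat) : Prop :=
  forall mu : 'I_M -> probability (pt R d) R,
    (forall j, abs_cont (mu j)) ->
    exists (t : nat) (P : lpart R d r),
      iterated t P /\ size P = n /\
      forall j s, mu j (label_union P s) = (r%:R^-1 : R)%:E.

Definition is_largest (P : nat -> Prop) (m : nat) : Prop :=
  P m /\ forall m', P m' -> (m' <= m)%N.

(* Main.v *)
Require Import Defs.
From HB Require Import structures.
From mathcomp Require Import all_boot all_order all_algebra.
From mathcomp Require Import all_classical all_reals all_analysis.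
From mathcomp Require Import measurable_realfun.
From mathcomp Require Import lra ring zify.
From Stdlib Require List.
Set Implicit Arguments. Unset Strict Implicit. Unset Printing Implicit Defensive.
Import Order.TTheory GRing.Theory Num.Theory.

(* Lower bound.  Cut R^d into t parallel slabs and put in each slab a power diagram of p = r affine
   functionals; Z_p acts by rotating the labels.  The configurations are parametrized by the join of
   t (d + 1) copies of the boundary of the (p - 1)-simplex, a sphere of dimension t (d + 1) (p - 1) - 1
   with a free action of Z_p.  If no configuration equipartitions the M measures, a configuration
   with p distinct functionals in every nonempty slab is labelled by a pair (j, s) for which the
   measure of the part s under mu_j is as large as possible: nearby configurations cannot carry all
   p labels (j, s) of one j.  A configuration with nearly coinciding functionals in some slab l
   determines a partition of Z_p into k classes, 1 < k < p; rotation moves this partition, so it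
   yields an element s of Z_p and the label ((l, k), s): nearby configurations cannot carry two
   labels of the same (l, k).  The labels thus form a complex of dimension
   M (p - 1) + t (p - 2) - 1, and a mod p version of Tucker's lemma gives a contradiction as soon as
   this is less than the dimension of the sphere.  A limit of almost equipartitions concludes.

   Tucker's lemma.  The sphere receives chains h_0, h_1, ..., where the boundary of h_k is
   (g - 1) h_(k-1) or (1 + g + ... + g^(p-1)) h_(k-1) according to the parity of k; on the labels
   there are dual alternating cochains, because Z_p acts freely.  Pulling these cochains back along
   the labelling of a fine barycentric subdivision, the pairing with h_k does not depend on k; it is
   1 for k = 0 and 0 in top dimension, where the labels of a simplex must repeat.

   Upper bounds.  If two parts of a power diagram both meet d + 1 small cubes at the vertices of a
   simplex, the hyperplane between them meets all these cubes, which is impossible.  On the line a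
   t-iterated partition into 2 t parts has at most 2 t - 1 cut points, which miss one of 2 t disjoint
   intervals. *)

Local Open Scope ring_scope.

(** * Alternating cochains and exactness *)

Section Cochains.
Variable G : pzRingType.

(* Coboundary of a cochain [f], evaluated at the tuple [s]; chains only occur through such
   functionals on cochains. *)
Fixpoint cobd (X : Type) (s : seq X) (f : seq X -> G) : G :=
  if s is x :: s' then f s' - cobd s' (fun r => f (x :: r)) else 0.

Lemma eq_cobd (X : eqType) (s : seq X) (f g : seq X -> G) :
  (forall r, (size r).+1 = size s -> {subset r <= s} -> f r = g r) ->
  cobd s f = cobd s g.
Proof.
elim: s f g => //= x s IH f g fg; congr (_ - _).
  by apply: fg => // y ys; rewrite inE ys orbT.
apply: IH => r szr rs; apply: fg => [|y]; first by rewrite /= szr.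
by rewrite !inE => /predU1P[->|/rs ->]; rewrite ?eqxx ?orbT.
Qed.

Lemma cobd_ext (X : Type) (s : seq X) (f g : seq X -> G) :
  f =1 g -> cobd s f = cobd s g.
Proof.
by elim: s f g => //= x s IH f g fg; rewrite fg; congr (_ - _); apply: IH => r.
Qed.

Lemma cobd0 (X : Type) (s : seq X) : cobd s (fun=> 0) = 0.
Proof. by elim: s => //= x s ->; rewrite subrr. Qed.

Lemma cobdB (X : Type) (s : seq X) (f g : seq X -> G) :
  cobd s (fun r => f r - g r) = cobd s f - cobd s g.
Proof.
elim: s f g => [|x s IH] f g /=; first by rewrite subrr.
by rewrite IH opprB opprB addrACA [RHS]addrACA; congr (_ + _); rewrite addrC.
Qed.

Lemma cobdN (X : Type) (s : seq X) (f : seq X -> G) :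
  cobd s (fun r => - f r) = - cobd s f.
Proof.
have := cobdB s (fun=> 0) f; rewrite cobd0 sub0r => <-.
by apply: cobd_ext => r; rewrite sub0r.
Qed.

Lemma cobd_sum (X : Type) (s : seq X) (I : Type) (r : seq I) (F : I -> seq X -> G) :
  cobd s (fun t => \sum_(i <- r) F i t) = \sum_(i <- r) cobd s (F i).
Proof.
elim: r => [|i r IH].
  by rewrite big_nil -[RHS](cobd0 s); apply: cobd_ext => t; rewrite big_nil.
rewrite big_cons -IH -[X in _ + X]opprK -cobdN -cobdB.
by apply: cobd_ext => t; rewrite big_cons opprK.
Qed.

Lemma cobd_cobd (X : Type) (s : seq X) (f : seq X -> G) :
  cobd s (fun r => cobd r f) = 0.
Proof.
by elim: s f => //= x s IH f; rewrite cobdB IH subr0 subrr.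
Qed.

Lemma cobd_map (X Y : Type) (h : X -> Y) (s : seq X) (f : seq Y -> G) :
  cobd (map h s) f = cobd s (fun r => f (map h r)).
Proof. by elim: s f => //= x s IH f; rewrite IH. Qed.

(** The second clause does not follow from the first when 2 = 0, which is the case p = 2. *)
Definition alternating (X : Type) (f : seq X -> G) : Prop :=
  (forall a x y b, f (a ++ x :: y :: b) = - f (a ++ y :: x :: b)) /\
  (forall a x b, f (a ++ x :: x :: b) = 0).

Lemma alternating_behead (X : Type) (f : seq X -> G) z :
  alternating f -> alternating (fun r => f (z :: r)).
Proof.
case=> fs f0; split=> [a x y b|a x b].
  by rewrite -!cat_cons; apply: (fs (z :: a) x y b).
by rewrite -!cat_cons; apply: (f0 (z :: a) x b).
Qed.

Lemma alternating_cobd (X : Type) (f : seq X -> G) :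
  alternating f -> alternating (fun s => cobd s f).
Proof.
move=> altf; split=> a.
  elim: a f altf => [|z a IH] f altf x y b /=.
    rewrite (_ : cobd b (fun r => f [:: x, y & r]) =
                 - cobd b (fun r => f [:: y, x & r])).
      by rewrite !opprD !opprK addrCA addrA.
    by rewrite -cobdN; apply: cobd_ext => r; rewrite (altf.1 [::]).
  rewrite (IH _ (alternating_behead z altf) x y b) (altf.1 a x y b).
  by rewrite opprK opprB addrC.
elim: a f altf => [|z a IH] f altf x b /=.
  rewrite (_ : cobd b (fun r => f [:: x, x & r]) = 0) ?subr0 ?subrr //.
  by rewrite -[RHS](cobd0 b); apply: cobd_ext => r; rewrite (altf.2 [::]).
by rewrite (IH _ (alternating_behead z altf) x b) (altf.2 a x b) subrr.
Qed.

(** Adjacent transpositions, which only change the sign, bring the two equal entries next to each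
    other. *)
Lemma alternating_nuniq (X : eqType) (f : seq X -> G) (s : seq X) :
  alternating f -> ~~ uniq s -> f s = 0.
Proof.
move=> [fs f0] nus.
have [a [x [b [c ->]]]] : exists a x b c, s = a ++ x :: b ++ x :: c.
  elim: s nus => //= y s IH; rewrite negb_and negbK => /orP[ys|/IH].
    by have [i j] := splitPr ys; exists [::], y, i, j.
  by move=> [a [x [b [c ->]]]]; exists (y :: a), x, b, c.
elim: b a => [|y b IH] a /=; first exact: f0.
by rewrite fs -cat_rcons IH oppr0.
Qed.

Lemma alternating_mul (X : eqType) (f c : seq X -> G) :
  alternating f -> (forall s s', s =i s' -> c s = c s') ->
  alternating (fun s => f s * c s).
Proof.
move=> [fs f0] ceq; split=> [a x y b|a x b]; last by rewrite f0 mul0r.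
rewrite fs mulNr; congr (- (_ * _)); apply: ceq => z.
by rewrite !mem_cat !inE; congr (_ || _); rewrite orbCA.
Qed.
End Cochains.

(** * The action of Z_p on labels and the exactness of its cochains *)

Section Shift.
Variables (q : nat) (J : finType).
Hypothesis p_pr : prime q.+2.
Local Notation G := 'I_q.+2.
Local Notation T := (J * G)%type.

Definition shift (a : G) (x : T) : T := (x.1, x.2 + a).

Definition column (s : seq T) (j : J) : {set G} := [set a | (j, a) \in s].

Lemma shiftD a b x : shift a (shift b x) = shift (a + b) x.
Proof. by case: x => j c; rewrite /shift /= -addrA (addrC b). Qed.

Lemma map_shiftD a b s : map (shift a) (map (shift b) s) = map (shift (a + b)) s.
Proof. by rewrite -map_comp; apply: eq_map => x; rewrite /= shiftD. Qed.

Lemma map_shift0 s : map (shift 0) s = s.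
Proof. by rewrite map_id_in // => -[j c] _; rewrite /shift addr0. Qed.

Lemma column_shift a s j : column (map (shift a) s) j = [set b + a | b in column s j].
Proof.
apply/setP => b; apply/idP/imsetP.
  rewrite inE => /mapP[[j' c] cs [-> ->]]; exists c => //; by rewrite inE.
by case=> c; rewrite inE => cs ->; rewrite inE; apply/mapP; exists (j, c).
Qed.

Lemma card_column_shift a s j : #|column (map (shift a) s) j| = #|column s j|.
Proof. by rewrite column_shift card_imset //; exact: addIr. Qed.

Variable cap : J -> nat.
Hypothesis cap_lt : forall j, (cap j < q.+2)%N.

(** Membership in the label complex. As [cap j] is less than p, no column is full, so a nontrivial
    rotation fixes no nonempty simplex. *)
Definition allowed (s : seq T) : bool := [forall j, #|column s j| <= cap j]%N.

Lemma allowed_shift a s : allowed (map (shift a) s) = allowed s.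
Proof. by apply: eq_forallb => j; rewrite card_column_shift. Qed.

Lemma allowed_sub s s' : {subset s <= s'} -> allowed s' -> allowed s.
Proof.
move=> ss /forallP al; apply/forallP => j; apply: leq_trans (al j).
by apply: subset_leq_card; apply/fintype.subsetP => a; rewrite !inE => /ss.
Qed.

Lemma size_allowed s : allowed s -> uniq s -> (size s <= \sum_j cap j)%N.
Proof.
move=> /forallP al us; rewrite -(card_uniqP us).
rewrite -sum1_card (partition_big fst predT) //=; apply: leq_sum => j _.
apply: leq_trans (al j); rewrite sum1dep_card.
rewrite -(card_imset (column s j) (f := fun a => (j, a))); last by move=> a b [].
apply: subset_leq_card; apply/fintype.subsetP => -[j' a]; rewrite inE /= => /andP[js /eqP <-].
by apply/imsetP; exists a; rewrite ?inE.
Qed.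

(* [#|A|] is a unit for a nonempty proper subset [A], so that translating [A] translates its mean. *)
Definition mean (A : {set G}) : G := (\sum_(a in A) a) / #|A|%:R.

Lemma unit_small n : (0 < n < q.+2)%N -> (n%:R : G) \is a GRing.unit.
Proof.
move=> /andP[n0 nq]; rewrite (unitZpE (p := q.+2)) // prime_coprime //.
by rewrite gtnNdvd.
Qed.

Lemma mean_shift (A : {set G}) c : (0 < #|A| < q.+2)%N ->
  mean [set b + c | b in A] = mean A + c.
Proof.
move=> cA; rewrite /mean card_imset; last exact: addIr.
rewrite big_imset /=; last by move=> x y _ _; exact: addIr.
rewrite big_split /= mulrDl sumr_const; congr (_ + _).
by rewrite -[X in X / _]mulr_natr mulrK // unit_small.
Qed.

(** Rotation does not change which columns are nonempty, so the same column is picked and its mean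
    moves with the rotation. The value 0 is the default for the empty tuple. *)
Definition phase (s : seq T) : G :=
  if [pick j | column s j != finset.set0] is Some j then mean (column s j) else 0.

Lemma eq_phase s s' : s =i s' -> phase s = phase s'.
Proof.
move=> ss; rewrite /phase (eq_pick (Q := fun j => column s' j != finset.set0)) => [|j].
  by case: pickP => // j _; congr mean; apply/setP => a; rewrite !inE ss.
by congr (_ != _); apply/setP => a; rewrite !inE ss.
Qed.

Lemma phase_shift s c : s != [::] -> allowed s ->
  phase (map (shift c) s) = phase s + c.
Proof.
move=> s0 /forallP al; have [[j0 a0] sx] : exists x, x \in s.
  by case: (s) s0 => // x t _; exists x; rewrite mem_head.
rewrite /phase (eq_pick (Q := fun j => column s j != finset.set0)); last first.
  by move=> j /=; rewrite -!card_gt0 card_column_shift.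
case: pickP => [j cj|/(_ j0)].
  by rewrite column_shift mean_shift // card_gt0 cj (leq_ltn_trans (al j)).
by move/negbFE/eqP/setP/(_ a0); rewrite !inE sx.
Qed.

(* The differentials g - 1 and 1 + g + ... + g^(p-1) of the minimal resolution of Z_p. *)
Definition opB (X : Type) (act : G -> X -> X) (k : nat) (f : seq X -> G) (s : seq X) : G :=
  if odd k then f (map (act 1) s) - f s else \sum_(a : G) f (map (act a) s).

Lemma cobd_opB (X : Type) (act : G -> X -> X) k f s :
  cobd s (opB act k f) = opB act k (fun r => cobd r f) s.
Proof.
rewrite /opB; case: (odd k); first by rewrite cobdB cobd_map.
by rewrite cobd_sum; apply: eq_bigr => a _; rewrite cobd_map.
Qed.

Lemma opB_ext (X : Type) (act : G -> X -> X) k f g s :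
  f =1 g -> opB act k f s = opB act k g s.
Proof. by move=> fg; rewrite /opB; case: ifP => _; rewrite ?fg //; apply: eq_bigr. Qed.

(** One of the two operators is the sum over Z_p, which a further rotation leaves unchanged; the
    other is the difference between a rotation and the identity. *)
Lemma opB_opB (X : Type) (act : G -> X -> X) k f s :
  (forall a b x, act a (act b x) = act (a + b) x) ->
  opB act k (opB act k.+1 f) s = 0.
Proof.
move=> actD.
have mD a b r : map (act a) (map (act b) r) = map (act (a + b)) r.
  by rewrite -map_comp; apply: eq_map => x; rewrite /= actD.
have sh (F : G -> G) c : \sum_a F (a + c) = \sum_a F a.
  rewrite [RHS](reindex_inj (h := fun a => a + c)) //; exact: addIr.
rewrite /opB /=; case: (odd k) => /=.
  apply/eqP; rewrite subr_eq0; apply/eqP.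
  rewrite -[RHS](sh (fun a => f (map (act a) s)) 1).
  by apply: eq_bigr => a _; rewrite mD.
rewrite sumrB; apply/eqP; rewrite subr_eq0; apply/eqP.
rewrite -[RHS](sh (fun a => f (map (act a) s)) 1).
by apply: eq_bigr => a _; rewrite mD addrC.
Qed.

(* [phase] identifies every orbit of nonempty allowed tuples with Z_p, equivariantly. *)
Lemma opB_exact (k : nat) (w : seq T -> G) :
  alternating w ->
  (forall s, size s = k.+1 -> allowed s -> opB shift k w s = 0) ->
  exists2 u : seq T -> G, alternating u &
    forall s, size s = k.+1 -> allowed s -> w s = opB shift k.+1 u s.
Proof.
rewrite /opB /=; case: (odd k) => /= altw Bw.
  (* For odd [k] the hypothesis says that [w] is invariant. Keeping it on phase 0 only leaves one
     tuple of each orbit, and the sum over Z_p restores [w]. *)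
  exists (fun s => w s * (phase s == 0)%:R).
    by apply: alternating_mul => // s s' ss; rewrite (eq_phase ss).
  move=> s szs als; rewrite (bigD1 (- phase s)) //=.
  have inv n : w (map (shift n%:R) s) = w s.
    elim: n => [|n IH]; first by rewrite map_shift0.
    rewrite -IH mulrS -map_shiftD; apply/eqP; rewrite -subr_eq0 Bw //.
      by rewrite size_map.
    by rewrite allowed_shift.
  have s0 : s != [::] by case: (s) szs.
  rewrite phase_shift // subrr eqxx mulr1 big1 ?addr0 => [|a an].
    by rewrite -(inv (val (- phase s))) natr_Zp.
  by rewrite phase_shift // addrC addr_eq0 (negPf an) mulr0.
(* For even [k], [u] is a discrete primitive along the orbit: the sum of [w] over the rotates of [s]
   by -1, ..., - [phase s]. *)
pose u s := \sum_(i < q.+2) w (map (shift (- (i : G) - 1)) s) * ((i < phase s)%N)%:R.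
exists u.
  split=> [a x y b|a x b].
    rewrite /u -sumrN; apply: eq_bigr => i _.
    by have [/(_ a x y b) H _] := alternating_mul (c := fun s => ((i < phase s)%N)%:R)
      altw (fun s s' ss => congr1 (fun z : G => ((i < z)%N)%:R) (eq_phase ss));
      move: H; rewrite !map_cat /= => H; case: altw => fs _;
      rewrite fs mulNr; congr (- (_ * _));
      rewrite (@eq_phase _ (a ++ y :: x :: b)) // => z; rewrite !mem_cat !inE;
      congr (_ || _); rewrite orbCA.
  rewrite /u big1 // => i _; case: altw => _ f0.
  by rewrite map_cat /= f0 mul0r.
move=> s szs als; have s0 : s != [::] by case: (s) szs.
rewrite /u phase_shift //.
under [X in _ = X - _]eq_bigr do rewrite map_shiftD subrK.
have -> : \sum_(i < q.+2) w (map (shift (- (i : G) - 1)) s) * ((i < phase s)%N)%:R =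
  \sum_(i : G) w (map (shift (- i)) s) * ((nat_of_ord (i - 1)%R < phase s)%N)%:R.
  rewrite [RHS](reindex_inj (h := fun a : G => a + 1)); last exact: addIr.
  by apply: eq_bigr => i _; rewrite opprD addrK.
rewrite -sumrB.
have Bs : \sum_(i : G) w (map (shift (- i)) s) = 0.
  rewrite -[RHS](Bw s szs als) [RHS](reindex_inj oppr_inj) /=; exact: eq_bigr.
have valB1 (i : G) : i != 0 -> val (i - 1) = (val i).-1.
  move=> i0; have i_gt0 : (0 < i)%N by rewrite lt0n.
  have -> : val (i - 1) = ((i + (q.+2 - 1 %% q.+2) %% q.+2) %% q.+2)%N by [].
  rewrite (@modn_small 1) // subn1 /= (@modn_small q.+1) // -{1}(prednK i_gt0).
  by rewrite addSnnS modnDr modn_small // (leq_ltn_trans (leq_pred _)).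
have valN1 : val (- 1 : G) = q.+1.
  have -> : val (- 1 : G) = ((q.+2 - 1 %% q.+2) %% q.+2)%N by [].
  by rewrite (@modn_small 1) // subn1 modn_small.
(* Indexed by the same rotates, the two sums differ by the term [i = 0] and by a constant
   coefficient, nonzero only when the phase wraps around; [Bs] removes the constant. *)
have key (i : G) : ((i < (phase s + 1)%R)%N)%:R - ((nat_of_ord (i - 1)%R < phase s)%N)%:R =
   ((i == 0)%:R - (phase s + 1 == 0)%:R : G).
  have valD1 : phase s + 1 != 0 -> val (phase s + 1) = (val (phase s)).+1.
    move=> r0; have := valB1 _ r0; rewrite addrK => ->; rewrite prednK // lt0n; exact: r0.
  have [->|i0] := eqVneq i 0.
    have -> : (nat_of_ord ((0 : G) - 1)%R < phase s)%N = false.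
      by apply/negbTE; rewrite -leqNgt sub0r [X in (_ <= X)%N]valN1 -ltnS ltn_ord.
    rewrite subr0; have -> : (0 < (phase s + 1)%R)%N = (phase s + 1 != 0).
      by rewrite lt0n.
    by case: eqP; rewrite ?subr0 ?subrr.
  rewrite valB1 // sub0r; have [r0|r0] := eqVneq (phase s + 1) 0.
    have -> : val (phase s) = q.+1.
      by have -> : phase s = - 1; [rewrite -sub0r -r0 addrK | exact: valN1].
    have -> : (i.-1 < q.+1)%N by rewrite -ltnS prednK ?lt0n // ltn_ord.
    by rewrite r0 ltn0 sub0r.
  by rewrite valD1 // oppr0 -ltnS prednK ?subrr // lt0n.
under eq_bigr do rewrite -mulrBr key mulrBr.
rewrite sumrB -mulr_suml Bs mul0r subr0 (bigD1 0) //= mulr1 oppr0 map_shift0.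
by rewrite big1 ?addr0 // => i /negPf ->; rewrite mulr0.
Qed.
End Shift.

(** * Equivariant selections *)

Section Components.
Variable T : finType.
Implicit Type e : rel T.

Definition block e (s : T) : {set T} := [set s' | connect e s s'].
Definition blocks e : {set {set T}} := [set block e s | s in T].

Lemma eq_block e s s' : symmetric e -> (block e s == block e s') = connect e s s'.
Proof.
move=> es; have cs := sym_connect_sym es.
apply/eqP/idP => [/setP/(_ s')|ss']; first by rewrite !inE connect0.
by apply/setP => u; rewrite !inE (same_connect cs ss').
Qed.

Lemma blocks_coarser e e' : symmetric e -> symmetric e' -> subrel e e' ->
  exists2 f : {set T} -> {set T}, blocks e' = f @: blocks e &
    forall s, f (block e s) = block e' s.
Proof.
move=> es es' ee'; have cc' s s' : connect e s s' -> connect e' s s'.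
  by apply: connect_sub => u v /ee'; exact: connect1.
pose f (B : {set T}) := \bigcup_(s in B) block e' s.
have fE s : f (block e s) = block e' s.
  apply/setP => u; apply/bigcupP/idP => [[v]|us].
    rewrite !inE => /cc' sv; exact: connect_trans.
  by exists s; rewrite ?inE ?connect0 // in us *.
exists f => //; rewrite /blocks -imset_comp; apply: eq_imset => s /=; by rewrite fE.
Qed.

Lemma leq_card_blocks e e' : symmetric e -> symmetric e' -> subrel e e' ->
  (#|blocks e'| <= #|blocks e|)%N.
Proof. by move=> es es' /(blocks_coarser es es')[f -> _]; exact: leq_imset_card. Qed.

(** Blocks map onto coarser blocks; if their number does not drop, the map is injective and nothing
    is merged. *)
Lemma eq_connect_card e e' : symmetric e -> symmetric e' -> subrel e e' ->
  (#|blocks e| <= #|blocks e'|)%N -> connect e =2 connect e'.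
Proof.
move=> es es' ee' card_le s s'; have [f fE fb] := blocks_coarser es es' ee'.
have /imset_injP inj : #|f @: blocks e| == #|blocks e| by rewrite eqn_leq leq_imset_card -fE.
by rewrite -!eq_block // -!fb; apply/eqP/eqP => [->//|]; apply: inj; exact: imset_f.
Qed.

Lemma card_blocks_gt0 e (s : T) : (0 < #|blocks e|)%N.
Proof. by rewrite card_gt0; apply/set0Pn; exists (block e s); exact: imset_f. Qed.

Lemma connect_card_blocks1 e s s' : symmetric e -> (#|blocks e| <= 1)%N -> connect e s s'.
Proof.
move=> es /card_le1_eqP H; rewrite -eq_block //; apply/eqP; apply: H; exact: imset_f.
Qed.

Lemma connect_card_blocksT e s s' : symmetric e -> (#|T| <= #|blocks e|)%N ->
  connect e s s' -> s = s'.
Proof.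
move=> es card_ge; rewrite -eq_block // => /eqP.
have /imset_injP inj : #|block e @: T| == #|T| by rewrite eqn_leq leq_imset_card.
by apply: inj.
Qed.

(** The union of the blocks of least size: it is determined by the partition alone, hence moves with
    it under rotation. *)
Definition small_blocks e : {set T} :=
  [set s | [forall s', #|block e s| <= #|block e s'|]%N].

Lemma small_blocks_gt0 e (s : T) : (0 < #|small_blocks e|)%N.
Proof.
rewrite card_gt0; apply/set0Pn; pose m := [arg min_(u < s) #|block e u|]%N.
exists m; rewrite inE; apply/forallP => u; rewrite /m.
by case: arg_minnP => // v _; exact.
Qed.

(* Equal sizes of all blocks would make their number divide the prime [#|T|]. *)
Lemma small_blocks_proper e : symmetric e -> prime #|T| ->
  (1 < #|blocks e| < #|T|)%N -> (#|small_blocks e| < #|T|)%N.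
Proof.
move=> es pT /andP[b1 bT]; rewrite ltn_neqAle max_card andbT; apply/negP => /eqP sT.
have sizeE s s' : #|block e s| = #|block e s'|.
  have small u : u \in small_blocks e.
    have /eqP -> : small_blocks e == finset.setT by rewrite eqEcard finset.subsetT cardsT sT leqnn.
    by rewrite inE.
  by apply/eqP; rewrite eqn_leq; have := small s; have := small s';
    rewrite !inE => /forallP -> /forallP ->.
have [s _] : exists s : T, true by case/card_gt0P: (prime_gt0 pT) => s; exists s.
have dvd : (#|blocks e| %| #|T|)%N.
  apply/dvdnP; exists #|block e s|; rewrite -[LHS]sum1_card.
  rewrite (partition_big (block e) (mem (blocks e))) /=; last by move=> u _; exact: imset_f.
  rewrite [RHS]mulnC -sum_nat_const; apply: eq_bigr => B /imsetP[u _ ->].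
  rewrite (sizeE s u) -sum1_card; apply: eq_bigl => v.
  by rewrite inE eq_block // (sym_connect_sym es).
by move: pT => /primeP[_ /(_ _ dvd)]; lia.
Qed.
End Components.

(** * Equivariant choice of an element of a subset of Z_p *)

Section PickEquivariant.
Variable q : nat.
Hypothesis p_pr : prime q.+2.
Local Notation G := 'I_q.+2.

Definition translate (a : G) (B : {set G}) : {set G} := [set b + a | b in B].

(* Centering [B] at its mean makes an arbitrary choice translation equivariant. *)
Definition select (B : {set G}) : G :=
  mean B + odflt 0 [pick b in translate (- mean B) B].

Lemma mem_translate a (B : {set G}) b : (b \in translate a B) = (b - a \in B).
Proof.
apply/imsetP/idP => [[c cB ->]|bB]; first by rewrite addrK.
by exists (b - a); rewrite ?subrK.
Qed.

Lemma card_translate a (B : {set G}) : #|translate a B| = #|B|.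
Proof. by rewrite card_imset //; exact: addIr. Qed.

Lemma select_in (B : {set G}) : (0 < #|B|)%N -> select B \in B.
Proof.
rewrite /select; case: pickP => [b|no]; first by rewrite mem_translate opprK addrC.
case/card_gt0P => b bB; have := no (b - mean B).
by rewrite mem_translate opprK subrK bB.
Qed.

Lemma select_translate a (B : {set G}) : (0 < #|B| < q.+2)%N -> select (translate a B) = select B + a.
Proof.
move=> cB; rewrite /select [mean (translate a B)]mean_shift // addrAC; congr (_ + odflt _ _ + _).
apply: eq_pick => b /=; rewrite !mem_translate !opprK.
by rewrite addrA addrK.
Qed.
End PickEquivariant.

(** * Subdivision and Tucker's lemma *)

Section Subdivision.
Variables (G : pzRingType) (R : realType) (V : normedModType R).

Definition bary (s : seq V) : V := (size s)%:R^-1 *: \sum_(x <- s) x.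

(** A substitute for convexity: the vertices of iterated subdivisions are iterated barycenters. *)
Definition bary_closed (C : V -> Prop) : Prop :=
  forall s, s != [::] -> (forall x, x \in s -> C x) -> C (bary s).

Fixpoint sd_rec (n : nat) (f : seq V -> G) (s : seq V) : G :=
  if n is m.+1 then cobd s (sd_rec m (fun r => f (bary s :: r))) else f [::].

(* The barycentric subdivision of the simplex [s] is the cone from [bary s] over the subdivision of
   its boundary; [sd f s] is the value of [f] on it. *)
Definition sd (f : seq V -> G) (s : seq V) : G := sd_rec (size s) f s.

Lemma sd_cons f x s :
  sd f (x :: s) = cobd (x :: s) (sd (fun r => f (bary (x :: s) :: r))).
Proof.
rewrite {1}/sd; apply: (@eq_cobd _ _ (x :: s)) => r [szr] _.
by rewrite /sd szr.
Qed.

Lemma sd_ext f g s : f =1 g -> sd f s = sd g s.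
Proof.
rewrite /sd; move: (size s) => n; elim: n s f g => //= n IH s f g fg.
by apply: cobd_ext => r; apply: IH => t; rewrite fg.
Qed.

Lemma sdB f g s : sd (fun r => f r - g r) s = sd f s - sd g s.
Proof.
rewrite /sd; move: (size s) => n; elim: n s f g => //= n IH s f g.
by rewrite -cobdB; apply: cobd_ext => r; rewrite IH.
Qed.

Lemma sd0 s : sd (fun=> 0) s = 0.
Proof.
rewrite /sd; move: (size s) => n; elim: n s => //= n IH s.
by rewrite -[RHS](cobd0 G s); apply: cobd_ext => r; rewrite IH.
Qed.

Lemma sd_sum (I : finType) (F : I -> seq V -> G) s :
  sd (fun r => \sum_i F i r) s = \sum_i sd (F i) s.
Proof.
rewrite /sd; move: (size s) => n; elim: n s F => //= n IH s F.
by rewrite -cobd_sum; apply: cobd_ext => r; rewrite (IH r (fun i t => F i (bary s :: t))).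
Qed.

(** The boundary of a cone is its base minus the cone over the boundary of the base. Here the base
    is a subdivided boundary, which is a cycle by induction. *)
Lemma sd_cobd f s : sd (fun r => cobd r f) s = cobd s (sd f).
Proof.
have [n szs] := ubnP (size s); elim: n => // n IH in s szs f *.
case: s szs => [//|x s] /= szs; rewrite sd_cons.
rewrite (@eq_cobd _ _ _ _ (fun r => sd f r - cobd r (sd (fun t => f (bary (x :: s) :: t))))).
  by rewrite cobdB cobd_cobd subr0.
move=> r [szr] _; rewrite sdB -IH ?szr //.
Qed.

Lemma sd_map (h : {linear V -> V}) f s : sd (fun r => f (map h r)) s = sd f (map h s).
Proof.
have baryh t : bary (map h t) = h (bary t).
  by rewrite /bary linearZZ size_map big_map; congr (_ *: _); rewrite linear_sum.
rewrite /sd size_map; move: (size s) => n; elim: n s f => //= n IH s f.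
rewrite cobd_map; apply: cobd_ext => r.
by rewrite -(IH r (fun t => f (bary (map h s) :: t))) baryh.
Qed.

Definition spread_le (D : R) (s : seq V) : Prop :=
  forall x y, x \in s -> y \in s -> `|x - y| <= D.

Lemma sum_const_seq (W : nmodType) (s : seq V) (c : W) : \sum_(y <- s) c = c *+ size s.
Proof. by rewrite big_const_seq count_predT iter_addr_0. Qed.

(** Of the differences [y - x] averaged over [s], the one with [y = x] vanishes; hence the factor
    below 1. *)
Lemma bary_dist s x D n : (size s <= n.+1)%N -> x \in s -> spread_le D s ->
  `|bary s - x| <= n%:R / n.+1%:R * D.
Proof.
move=> szs xs sD; have D0 : 0 <= D by apply: le_trans (sD x x xs xs).
have [m szm] : exists m, size s = m.+1 by case: (s) xs => // y t _; exists (size t).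
have m0 : 0 < m.+1%:R :> R by rewrite ltr0n.
have -> : bary s - x = m.+1%:R^-1 *: \sum_(y <- s) (y - x).
  rewrite /bary sumrB sum_const_seq szm -[x *+ _]scaler_nat.
  by rewrite scalerBr scalerA mulVf ?scale1r // gt_eqF.
rewrite normrZ ger0_norm ?invr_ge0 ?ler0n // [leLHS]mulrC ler_pdivrMr //.
apply: le_trans (ler_norm_sum _ _ _) _.
rewrite (perm_big _ (perm_to_rem xs)) big_cons /= subrr normr0 add0r.
have szr : size (rem x s) = m by rewrite size_rem // szm.
apply: (@le_trans _ _ (m%:R * D)).
  rewrite -szr mulr_natl -sum_const_seq big_seq [leRHS]big_seq.
  by apply: ler_sum => y /mem_rem ys; exact: sD.
rewrite mulrAC ler_wpM2r // mulrAC ler_pdivlMr ?ltr0n // -!natrM ler_nat.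
by rewrite szm in szs; nia.
Qed.

(** What has to be known of a simplex [r] of the subdivision of [s]: its number of vertices, that it
    lies in the hull of [s], and that its diameter has shrunk. *)
Definition sd_supp (n : nat) (s r : seq V) : Prop :=
  [/\ size r = size s,
      forall C, bary_closed C -> (forall x, x \in s -> C x) -> forall x, x \in r -> C x &
      forall D, spread_le D s -> spread_le (n%:R / n.+1%:R * D) r].

Lemma ball_bary_closed (c : V) (e : R) : bary_closed (fun y => `|c - y| <= e).
Proof.
move=> s s0 sC; have m0 : 0 < (size s)%:R :> R by rewrite ltr0n lt0n size_eq0.
have -> : c - bary s = (size s)%:R^-1 *: \sum_(y <- s) (c - y).
  rewrite /bary sumrB sum_const_seq -[c *+ _]scaler_nat.
  by rewrite scalerBr scalerA mulVf ?scale1r // gt_eqF.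
rewrite normrZ ger0_norm ?invr_ge0 ?ler0n // [leLHS]mulrC ler_pdivrMr //.
apply: le_trans (ler_norm_sum _ _ _) _.
rewrite mulr_natr -sum_const_seq big_seq [leRHS]big_seq.
by apply: ler_sum => y ys; exact: sC.
Qed.

Lemma eq_sd n (s : seq V) f g : (size s <= n.+1)%N ->
  (forall r, sd_supp n s r -> f r = g r) -> sd f s = sd g s.
Proof.
have [m szs] := ubnP (size s); elim: m => // m IH in s szs f g *.
case: s szs => [|x s] szs szn fg; first by apply: fg; split.
rewrite !sd_cons; apply: eq_cobd => t szt ts; apply: IH.
- by rewrite szt.
- by apply: leq_trans szn; rewrite -szt.
move=> r [szr rC rD]; apply: fg; split.
- by rewrite /= szr szt.
- move=> C Cc sC y; rewrite inE => /predU1P[->|]; first exact: Cc.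
  by apply: rC => // z /ts; exact: sC.
move=> D sD.
(* The ball around the barycenter contains the vertices of the face and is [bary_closed], so it
   contains the vertices of the subdivided face. *)
have Cb y : y \in r -> `|bary (x :: s) - y| <= n%:R / n.+1%:R * D.
  apply: (rC (fun z => `|bary (x :: s) - z| <= n%:R / n.+1%:R * D)).
    exact: ball_bary_closed.
  by move=> z /ts zs; apply: bary_dist.
have D0 : 0 <= n%:R / n.+1%:R * D.
  by rewrite mulr_ge0 ?divr_ge0 //; apply: le_trans (sD x x _ _) => //; rewrite mem_head.
have tD : spread_le D t by move=> y z /ts ys /ts zs; exact: sD.
move=> y z; rewrite !inE => /predU1P[->|yr] /predU1P[->|zr].
- by rewrite subrr normr0.
- exact: Cb.
- by rewrite distrC; exact: Cb.
- exact: rD.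
Qed.

Lemma eq_iter_sd n m (s : seq V) f g D : (size s <= n.+1)%N -> spread_le D s ->
  (forall r, size r = size s ->
     (forall C, bary_closed C -> (forall x, x \in s -> C x) -> forall x, x \in r -> C x) ->
     spread_le ((n%:R / n.+1%:R) ^+ m * D) r -> f r = g r) ->
  iter m sd f s = iter m sd g s.
Proof.
elim: m s D => [|m IH] s D szs sD fg /=.
  by apply: fg => // x y xs ys; rewrite expr0 mul1r; exact: sD.
apply: (eq_sd szs) => r [szr rC rD].
apply: IH (rD _ sD) _; first by rewrite szr.
move=> t szt tC tD; apply: fg.
- by rewrite szt.
- by move=> C Cc sC; apply: tC => //; exact: rC.
- by rewrite exprSr -mulrA.
Qed.

Lemma iter_sd_cobd m f s : iter m sd (fun r => cobd r f) s = cobd s (iter m sd f).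
Proof.
elim: m s => //= m IH s; rewrite -sd_cobd; exact: sd_ext.
Qed.
End Subdivision.

(** * Tucker's lemma modulo p *)

Section Tucker.
Variables (R : realType) (N q : nat) (J : finType).
Hypothesis p_pr : prime q.+2.
Local Notation G := 'I_q.+2.
Local Notation X := 'M[R]_(N.+1, q.+2).

Definition rot (a : G) (x : X) : X := \matrix_(i, s) x i (s - a).

Fact rot_linear a : linear (rot a).
Proof. by move=> k x y; apply/matrixP => i s; rewrite !mxE. Qed.
HB.instance Definition _ a := @GRing.isLinear.Build R X X *:%R (rot a) (rot_linear a).

Lemma rotD a b x : rot a (rot b x) = rot (a + b) x.
Proof. by apply/matrixP => i s; rewrite !mxE opprD addrA. Qed.

(* Vertex [k] lies in the copy number [k %/ (p - 1)] of the boundary of the simplex: a tuple of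
   rotated vertices with distinct indices never exhausts the [p] vertices of one copy. *)
Definition vertex (k : nat) : X :=
  \matrix_(i, s) ((i == (k %/ q.+1)%N :> nat) && (s == 0))%:R.

(** The join of N + 1 copies of the boundary of the simplex on Z_p: each row is a scaled point of
    one copy, and its zero entry puts it on the boundary. *)
Definition domain (x : X) : Prop :=
  [/\ forall i s, 0 <= x i s, \sum_i \sum_s x i s = 1 & forall i, exists s, x i s = 0].

(* The chain h_k, as a functional on cochains: the cone from [vertex k] over (g - 1) h_(k-1) or
   (1 + g + ... + g^(p-1)) h_(k-1). *)
Fixpoint chain (k : nat) (f : seq X -> G) : G :=
  if k is k'.+1 then chain k' (opB rot k (fun s => f (vertex k :: s)))
  else f [:: vertex 0].

Lemma chain_ext k f g : f =1 g -> chain k f = chain k g.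
Proof.
elim: k f g => [|k IH] f g fg /=; first exact: fg.
by apply: IH => s; apply: opB_ext => r.
Qed.

Lemma chainB k f g : chain k (fun s => f s - g s) = chain k f - chain k g.
Proof.
elim: k f g => //= k IH f g; rewrite -IH; apply: chain_ext => s.
rewrite /opB; case: ifP => _ /=; last by rewrite sumrB.
by rewrite !opprB addrACA [RHS]addrACA; congr (_ + _); rewrite addrC.
Qed.

Lemma chain0 k : chain k (fun=> 0) = 0.
Proof.
elim: k => //= k IH; rewrite -[RHS]IH; apply: chain_ext => s.
by rewrite /opB; case: ifP => _; rewrite ?subrr ?big1.
Qed.

(** The boundary of the cone [chain k.+1] is its base minus the cone over the boundary of the base;
    the latter vanishes by induction, since consecutive operators compose to zero. *)
Lemma chain_cobd k f : chain k.+1 (fun s => cobd s f) = chain k (opB rot k.+1 f).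
Proof.
elim: k f => [|k IH] f.
  by rewrite /= !/opB /= !subr0 opprB addrA subrK.
pose fx s := f (vertex k.+2 :: s).
rewrite [LHS](_ : _ = chain k.+1 (fun s => opB rot k.+2 f s - cobd s (opB rot k.+2 fx))).
  have zero : chain k (opB rot k.+1 (opB rot k.+2 fx)) = 0.
    by rewrite -[RHS](chain0 k); apply: chain_ext => s; exact/opB_opB/rotD.
  by rewrite chainB IH zero subr0.
apply: (@chain_ext k.+1) => s; rewrite cobd_opB /opB; case: ifP => _ /=; last by rewrite sumrB.
by rewrite !opprB addrACA [RHS]addrACA; congr (_ + _); rewrite addrC.
Qed.

Definition vertex_tuple (k : nat) (s : seq X) : Prop :=
  size s = k.+1 /\ exists a : nat -> G,
    forall x, x \in s -> exists2 i, (i <= k)%N & x = rot (a i) (vertex i).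

Lemma rot0 x : rot 0 x = x.
Proof. by apply/matrixP => i s; rewrite !mxE subr0. Qed.

Lemma vertex_tuple_rot k s a : vertex_tuple k s -> vertex_tuple k (map (rot a) s).
Proof.
case=> szs [b sb]; split; first by rewrite size_map.
exists (fun i => a + b i) => _ /mapP[x /sb[i ik ->] ->]; exists i => //; exact: rotD.
Qed.

Lemma vertex_tuple_cons k s : vertex_tuple k s -> vertex_tuple k.+1 (vertex k.+1 :: s).
Proof.
case=> szs [b sb]; split; first by rewrite /= szs.
exists (fun i => if i == k.+1 then 0 else b i) => x.
rewrite inE => /predU1P[->|/sb[i ik ->]]; first by exists k.+1; rewrite ?eqxx ?rot0.
by exists i; [exact: leqW|rewrite ltn_eqF].
Qed.

Lemma eq_chain k f g : (forall s, vertex_tuple k s -> f s = g s) -> chain k f = chain k g.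
Proof.
elim: k f g => [|k IH] f g fg /=.
  apply: fg; split => //; exists (fun=> 0) => x; rewrite inE => /eqP ->.
  by exists 0%N; rewrite ?rot0.
apply: IH => s vs; rewrite /opB; case: ifP => _.
  by rewrite !fg //; apply: vertex_tuple_cons => //; exact: vertex_tuple_rot.
by apply: eq_bigr => a _; apply: fg; apply: vertex_tuple_cons; exact: vertex_tuple_rot.
Qed.

(** Row [i] meets only p - 1 vertex indices, each with a single rotation, so they miss some column
    [free i]. The face where all entries [x i (free i)] vanish contains the whole tuple. *)
Lemma vertex_tuple_domain k s : (k < N.+1 * q.+1)%N -> vertex_tuple k s ->
  exists D : X -> Prop, [/\ bary_closed D, forall x, x \in s -> D x &
    forall x, D x -> domain x].
Proof.
move=> kN [szs [a sa]].
pose used (i : 'I_N.+1) : {set G} := [set a (i * q.+1 + j)%N | j : 'I_q.+1].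
have /choice[free freeP] : forall i, exists b, b \notin used i.
  move=> i; apply/existsP; rewrite -negb_forall; apply/negP => /forallP H.
  have : (#|[set: G]| <= #|used i|)%N.
    by apply: subset_leq_card; apply/fintype.subsetP => b _; exact: H.
  by rewrite cardsT card_ord leqNgt ltnS (leq_trans (leq_imset_card _ _)) ?card_ord.
exists (fun x => [/\ forall i b, 0 <= x i b, \sum_i \sum_b x i b = 1 &
  forall i, x i (free i) = 0]).
split.
- move=> t t0 tD; have m0 : 0 < (size t)%:R :> R by rewrite ltr0n lt0n size_eq0.
  have E i b : bary t i b = (size t)%:R^-1 * \sum_(x <- t) x i b.
    by rewrite /bary mxE; congr (_ * _); elim/big_rec2: _ => [|y z w _ <-]; rewrite mxE.
  split.
  + move=> i b; rewrite E mulr_ge0 ?invr_ge0 ?ler0n // big_seq sumr_ge0 // => x /tD[].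
    exact.
  + under eq_bigr do under eq_bigr do rewrite E.
    under eq_bigr do rewrite -mulr_sumr exchange_big.
    rewrite -mulr_sumr exchange_big /= (_ : \sum_(j <- t) _ = \sum_(j <- t) 1).
      by rewrite sum_const_seq mulVf // gt_eqF.
    by rewrite big_seq [RHS]big_seq; apply: eq_bigr => x /tD[].
  + move=> i; rewrite E big_seq big1 ?mulr0 // => x /tD[_ _]; exact.
- move=> _ /sa[i ik ->].
  have iN : (i %/ q.+1 < N.+1)%N by rewrite ltn_divLR // (leq_ltn_trans ik).
  split.
  + by move=> j b; rewrite !mxE ler0n.
  + rewrite (bigD1 (Ordinal iN)) //= (bigD1 (a i)) //= !mxE /= eqxx subrr eqxx.
    rewrite !big1 ?addr0 // => [j jN|b bi].
      apply: big1 => b _; rewrite !mxE.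
      by case: eqP => // ji; case/eqP: jN; apply/val_inj.
    by rewrite !mxE subr_eq0 (negPf bi) andbF.
  + move=> j; rewrite !mxE; case: eqP => //= ji; rewrite subr_eq0; case: eqP => // fa.
    case/negP: (freeP j); rewrite fa; apply/imsetP.
    exists (Ordinal (ltn_pmod i (ltn0Sn q))) => //=.
    by rewrite ji -divn_eq.
- by move=> x [x0 x1 xf]; split=> // i; exists (free i).
Qed.

Lemma domain_norm x : domain x -> `|x| <= 1.
Proof.
case=> x0 x1 _; rewrite /Num.Def.normr /= mx_normrE; apply: bigmax_le => //= -[i b] _ /=.
rewrite ger0_norm // -x1 (bigD1 i) //= (bigD1 b) //= -addrA lerDl.
by rewrite addr_ge0 // !sumr_ge0 // => j _; rewrite sumr_ge0.
Qed.

Variables (cap : J -> nat) (lab : X -> J * G).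
Hypothesis cap_lt : forall j, (cap j < q.+2)%N.
Hypothesis sum_cap : (\sum_j cap j < N.+1 * q.+1)%N.
Hypothesis lab_rot : forall a x, domain x -> lab (rot a x) = shift a (lab x).

Let pull (m : nat) (v : seq (J * G) -> G) : seq X -> G :=
  iter m (@sd _ _ _) (fun r => v (map lab r)).

Lemma iter_sd_nil (V : normedModType R) m (f : seq V -> G) : iter m (@sd _ _ _) f [::] = f [::].
Proof. by elim: m => //= m <-. Qed.

Lemma pull_cobd m v s : pull m (fun r => cobd r v) s = cobd s (pull m v).
Proof.
rewrite -iter_sd_cobd /pull; congr (iter m _ _ s); apply/funext => r.
by rewrite cobd_map.
Qed.

Lemma opB_pull m k v s :
  opB rot k (pull m v) s = iter m (@sd _ _ _) (opB rot k (fun r => v (map lab r))) s.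
Proof.
elim: m s => [//|m IH] s.
rewrite [RHS](_ : _ = sd (opB rot k (pull m v)) s); last by apply: sd_ext => r; rewrite IH.
have sdr a : pull m.+1 v (map (rot a) s) = sd (fun r => pull m v (map (rot a) r)) s.
  by rewrite (sd_map (rot a)).
rewrite /opB; case: ifP => _; first by rewrite sdB sdr.
by rewrite sd_sum; apply: eq_bigr => a _; exact: sdr.
Qed.

Theorem tucker (eps : R) : 0 < eps ->
  exists s : seq X, [/\ forall x, x \in s -> domain x, spread_le eps s &
    ~~ allowed cap (map lab s)].
Proof.
move=> eps0; apply: contrapT => noS.
have small r : (forall x, x \in r -> domain x) -> spread_le eps r -> allowed cap (map lab r).
  by move=> rD rs; apply: contrapT => /negP nal; apply: noS; exists r.
(* The dimension of the sphere: simplices of the top chain have n + 1 vertices. *)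
pose n := (N.+1 * q.+1).-1.
have nE : n.+1 = (N.+1 * q.+1)%N by rewrite prednK // muln_gt0.
(* The domain has diameter at most 2, and each subdivision shrinks simplices by the factor n / (n +
   1). *)
have [m hm] : exists m, (n%:R / n.+1%:R) ^+ m * 2 <= eps.
  have k1 : `|n%:R / n.+1%:R : R| < 1.
    by rewrite ger0_norm ?divr_ge0 // ltr_pdivrMr ?ltr0n // mul1r ltr_nat.
  have e2 : 0 < eps / 2 by rewrite divr_gt0.
  have /cvgr0_norm_lt /(_ _ e2) [m _ /(_ m (leqnn m))] := cvg_expr k1.
  rewrite /= => /ltW hm; exists m; rewrite -ler_pdivlMr //.
  by apply: le_trans hm; rewrite ler_norm.
(* By the assumption for contradiction all small simplices have allowed labels, so the values of
   cochains elsewhere do not affect their pullbacks. *)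
have eq_pull k (f g : seq X -> G) s : (k <= n)%N -> vertex_tuple k s ->
    (forall r, size r = k.+1 -> (forall x, x \in r -> domain x) ->
      allowed cap (map lab r) -> f r = g r) ->
    iter m (@sd _ _ _) f s = iter m (@sd _ _ _) g s.
  move=> kn vs fg; have [szs _] := vs.
  have kN : (k < N.+1 * q.+1)%N by rewrite -nE.
  have [D [Dc sD Dd]] := vertex_tuple_domain kN vs.
  apply: (@eq_iter_sd _ _ _ n m s f g 2).
  - by rewrite szs.
  - move=> x y /sD/Dd/domain_norm xn /sD/Dd/domain_norm yn.
    by apply: le_trans (ler_normB _ _) _; rewrite -[2]/(1 + 1) lerD.
  move=> r szr rC rs; have rd x : x \in r -> domain x by move=> xr; apply: Dd; exact: (rC D Dc sD).
  apply: fg => //; first by rewrite szr szs.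
  by apply: small => // x y xr yr; apply: le_trans (rs _ _ xr yr) hm.
(* Proved by induction in every degree k up to n: the coboundary of [v] is killed by [opB] of degree
   k on allowed tuples, and its pullback pairs to 1 with [chain k]. *)
have [] // : exists2 v, alternating v & (forall s, size s = n.+1 -> allowed cap s ->
    opB (@shift q J) n (fun r => cobd r v) s = 0) /\ chain n (pull m (fun r => cobd r v)) = 1.
  have : (n <= n)%N by [].
  elim: {1 3 4 5}n => [_|k IH kn].
    (* The coboundary is 1 on every single label, and its sum over Z_p is p = 0. *)
    exists (fun s => (s == [::])%:R).
      have nil0 (a b : seq (J * G)) x : (a ++ x :: b == [::]) = false by case: a.
      by split=> *; rewrite !nil0 ?oppr0.
    split.
      move=> [|x [|]] //= _ _; rewrite /opB /=.
      under eq_bigr do rewrite subr0.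
      by rewrite sumr_const card_ord; exact: (@pchar_Zp q.+2 isT).
    by rewrite /= pull_cobd /= subr0 /pull iter_sd_nil.
  have [v altv [Bv cv]] := IH (ltnW kn).
  have [u altu uv] := opB_exact p_pr cap_lt (alternating_cobd altv) Bv.
  exists u => //; split.
    move=> s szs als; rewrite -cobd_opB -[RHS](cobd_cobd s v); apply: eq_cobd => r szr rs.
    rewrite uv //; first by move: szr; rewrite szs => -[].
    exact: allowed_sub als.
  (* Stokes: the coboundary of [u] on [chain k.+1] is [opB] of [u] on [chain k], which is the
     coboundary of [v] there by the choice of [u]. *)
  rewrite -cv (chain_ext _ (pull_cobd m u)) chain_cobd.
  apply: eq_chain => s vs; rewrite opB_pull.
  apply: (eq_pull k) => //; first exact: ltnW.
  move=> r szr rd ral.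
  have E a : map lab (map (rot a) r) = map (shift a) (map lab r).
    by rewrite -!map_comp; apply/eq_in_map => x /rd xd /=; exact: lab_rot.
  rewrite uv ?size_map // /opB; case: ifP => _; first by rewrite E.
  by apply: eq_bigr => a _; rewrite E.
move=> v altv [_ cv]; suff : (1 : G) = 0 by move/eqP; rewrite oner_eq0.
rewrite -cv -(chain0 n); apply: eq_chain => s vs.
have -> : (0 : G) = iter m (@sd G R X) (fun=> 0) s.
  elim: m {hm eq_pull cv} s {vs} => //= m IH s.
  by rewrite (_ : iter m _ _ = fun=> 0) ?sd0 //; apply/funext => r; rewrite -IH.
(* The n + 1 labels exceed the sum of the capacities, so they repeat and the alternating cochain
   vanishes. *)
apply: (eq_pull n) => // r szr rd ral.
apply: (alternating_nuniq (alternating_cobd altv)); apply/negP => us.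
by have := size_allowed ral us; rewrite size_map szr nE leqNgt sum_cap.
Qed.
End Tucker.

(** * Hyperplanes are null *)

Local Open Scope classical_set_scope.

Section Hyperplanes.
Variables (R : realType) (d : nat).
Local Notation pt := (pt R d).

Lemma measurable_affine (c : pt) (b : R) : measurable_fun setT (fun y : pt => dotp c y + b).
Proof.
apply: measurable_funD => //; apply: measurable_sum => i.
by apply: measurable_funM => //; exact: measurable_tnth.
Qed.

(** The cover is padded to a sequence by one-point boxes; their volume is 0 because d > 0, the empty
    product being 1. *)
Lemma null_of_finite_covers (A : set pt) : (0 < d)%N ->
  (forall eps : R, 0 < eps -> exists (I : finType) (a b : I -> pt),
    [/\ forall k i, tnth (a k) i <= tnth (b k) i,
        forall y, A y -> exists k, box (a k) (b k) y &
        \sum_k \prod_(i < d) (tnth (b k) i - tnth (a k) i) <= eps]) ->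
  lebesgue_null A.
Proof.
move=> d0 cov eps /cov[I [a [b [ab Acov sum_le]]]].
pose o : pt := [tuple 0 | i < d].
pose sel (f : I -> pt) k := if insub k is Some j then f (enum_val (j : 'I_#|I|)) else o.
pose vol k := \prod_(i < d) (tnth (sel b k) i - tnth (sel a k) i).
have vol0 k : 0 <= vol k.
  apply: prodr_ge0 => i _; rewrite subr_ge0 /sel.
  by case: insubP => [j _ _|_] //; exact: ab.
exists (sel a), (sel b); split; last split.
- by move=> k i; rewrite -subr_ge0 /sel; case: insubP => [j _ _|_]; rewrite ?subrr // subr_ge0.
- move=> y /Acov[k yk]; exists (enum_rank k) => //.
  by rewrite /sel valK enum_rankK.
- move=> n; apply: le_trans sum_le.
  have -> : \sum_k \prod_(i < d) (tnth (b k) i - tnth (a k) i) = \sum_(k < #|I|) vol k.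
    rewrite (reindex (@enum_val I predT)) /=; last first.
      by apply: onW_bij; exact: enum_val_bij.
    by apply: eq_bigr => j _; rewrite /vol /sel valK.
  have [nI|/ltnW In] := leqP n #|I|.
    rewrite -(subnKC nI) big_split_ord /= lerDl sumr_ge0 // => i _; exact: vol0.
  rewrite -(subnKC In) big_split_ord /= [X in _ + X]big1 ?addr0 // => i _.
  rewrite /vol (bigD1 (Ordinal d0)) //= /sel; case: insubP => [j|_].
    by rewrite -ltn_subRL subnn.
  by rewrite subrr mul0r.
Qed.

Lemma subinterval_exists (m : nat) (A s u : R) : (0 < m)%N -> A <= u <= A + m%:R * s ->
  exists k : 'I_m, A + k%:R * s <= u <= A + k.+1%:R * s.
Proof.
case: m => // m _; elim: m => [|m IH] /andP[Au us].
  by exists ord0; rewrite mul0r addr0 Au us.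
have [um|mu] := leP u (A + m.+1%:R * s); last by exists ord_max; rewrite ltW.
by have [|k] := IH; [rewrite Au|exists (widen_ord (leqnSn _) k)].
Qed.

(** The equation is solved for the coordinate with the largest coefficient. Over a grid cell of side
    [h] the solution then stays within [w = d h] of its value at the base point. *)
Lemma bounded_hyperplane_null (c : pt) (b : R) (n : nat) (i0 : 'I_d) :
  tnth c i0 != 0 -> (forall i, `|tnth c i| <= `|tnth c i0|) ->
  lebesgue_null [set y : pt | dotp c y + b = 0 /\ forall i, `|tnth y i| <= n%:R].
Proof.
move=> c0 cmax; have d0 : (0 < d)%N := leq_ltn_trans (leq0n i0) (ltn_ord i0).
apply: null_of_finite_covers => // eps eps0.
(* The m^d boxes constructed below, each of volume 2 d h^d / m, have total volume C / m. *)
pose C : R := 2 * d%:R * (2 * n%:R) ^+ d.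
have C0 : 0 <= C by rewrite /C !mulr_ge0 // exprn_ge0 // mulr_ge0.
have [m m0 mC] : exists2 m, (0 < m)%N & C <= m%:R * eps.
  exists (Num.truncn (C / eps)).+1 => //; rewrite -ler_pdivrMr //.
  by apply/ltW; have := truncnS_gt (C / eps).
have mR : 0 < m%:R :> R by rewrite ltr0n.
pose h : R := 2 * n%:R / m%:R; have h0 : 0 <= h by rewrite divr_ge0 // mulr_ge0.
pose w : R := d%:R * h; have w0 : 0 <= w by rewrite mulr_ge0.
pose base (f : {ffun 'I_d -> 'I_m}) j := - n%:R + (f j)%:R * h.
pose z (f : {ffun 'I_d -> 'I_m}) :=
  - (b + \sum_(j < d | j != i0) tnth c j * base f j) / tnth c i0.
(* The index [f i0] is not a grid position: it numbers the m slices of the interval of half-width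
   [w] around [z f]. *)
pose lo (f : {ffun 'I_d -> 'I_m}) j :=
  if j == i0 then z f - w + (f i0)%:R * (2 * w / m%:R) else base f j.
pose len j := if j == i0 then 2 * w / m%:R else h.
have len0 j : 0 <= len j by rewrite /len; case: ifP; rewrite // divr_ge0 // mulr_ge0.
exists {ffun 'I_d -> 'I_m}, (fun f => [tuple lo f j | j < d]),
  (fun f => [tuple lo f j + len j | j < d]); split.
- by move=> f i; rewrite !tnth_mktuple lerDl.
- move=> y [Hy yn].
  have cellj j : exists k : 'I_m, - n%:R + k%:R * h <= tnth y j <= - n%:R + k.+1%:R * h.
    apply: subinterval_exists => //; have := yn j; rewrite ler_norml => /andP[-> yj] /=.
    by rewrite /h mulrC mulfVK ?gt_eqF //; move: yj; lra.
  have /choice[g gP] := cellj.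
  pose f0 := [ffun j => g j].
  have yz : `|tnth y i0 - z f0| <= w.
    have yE : tnth y i0 - z f0 =
        - (\sum_(j < d | j != i0) tnth c j * (tnth y j - base f0 j)) / tnth c i0.
      apply: (mulIf c0); rewrite mulfVK // mulrBl mulfVK //.
      rewrite /dotp (bigD1 i0) //= in Hy.
      rewrite [in RHS](eq_bigr (fun j => tnth c j * tnth y j - tnth c j * base f0 j)) => [|j _].
        by rewrite sumrB; lra.
      by rewrite mulrBr.
    rewrite yE normrM normrN normfV ler_pdivrMr ?normr_gt0 //.
    apply: le_trans (ler_norm_sum _ _ _) _.
    rewrite /w -[X in X%:R * _]card_ord -mulrA mulr_natl -sumr_const.
    rewrite [leRHS](bigID (fun j => j != i0)) /= -[leLHS]addr0 lerD //; last first.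
      by apply: sumr_ge0 => j _; rewrite mulr_ge0.
    apply: ler_sum => j _; rewrite normrM mulrC ler_pM //.
    have /andP[gl gr] := gP j; rewrite /base ffunE ger0_norm; last by lra.
    by move: gr; rewrite -(natr1 (g j)); lra.
  have [k hk] : exists k : 'I_m, z f0 - w + k%:R * (2 * w / m%:R) <= tnth y i0
      <= z f0 - w + k.+1%:R * (2 * w / m%:R).
    apply: subinterval_exists => //; rewrite [m%:R * _]mulrC mulfVK ?gt_eqF //.
    by move: yz; rewrite ler_norml; lra.
  pose f := [ffun j => if j == i0 then k else g j].
  have basef j : j != i0 -> base f j = base f0 j by rewrite /base !ffunE => /negPf ->.
  have zf : z f = z f0.
    by rewrite /z; congr (- (_ + _) / _); apply: eq_bigr => j /basef ->.
  exists f => j; rewrite !tnth_mktuple /lo /len; case: (eqVneq j i0) => [->|ji].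
    rewrite zf ffunE eqxx; by move: hk; rewrite -(natr1 k); move: (2 * w / _) => S; lra.
  by rewrite basef // /base ffunE; have := gP j; rewrite -(natr1 (g j)) mulrDl mul1r addrA.
- rewrite (eq_bigr (fun=> 2 * d%:R * h ^+ d / m%:R)).
    rewrite sumr_const card_ffun !card_ord -[leLHS]mulr_natr natrX.
    have -> : 2 * d%:R * h ^+ d / m%:R * m%:R ^+ d = C / m%:R.
      by rewrite /h /C exprMn exprVn; field; rewrite expf_eq0 gt_eqF ?andbF //=.
    by rewrite ler_pdivrMr // mulrC.
  move=> f _; rewrite (bigD1 i0) //= !tnth_mktuple addrAC subrr add0r /len eqxx.
  rewrite (eq_bigr (fun=> h)) => [|j /negPf ji]; last first.
    by rewrite !tnth_mktuple addrAC subrr add0r ji.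
  rewrite prodr_const cardC1 card_ord /w; case: (d) d0 => // e _ /=.
  by rewrite exprS; field; rewrite gt_eqF.
Qed.

Lemma hyperplane_null (mu : probability pt R) (c : pt) (b : R) : abs_cont mu ->
  ((exists i, tnth c i != 0) \/ b != 0) ->
  mu.-negligible [set y : pt | dotp c y + b = 0].
Proof.
move=> ac; have [[i ci] _|c0] := pselect (exists i, tnth c i != 0); last first.
  move=> [//|b0]; apply: negligibleS (negligible_set0 mu) => y /=.
  rewrite /dotp big1 ?add0r => [bE|i _]; first by rewrite bE eqxx in b0.
  have /eqP -> : tnth c i == 0 by apply/negP => /negP ci; apply: c0; exists i.
  by rewrite mul0r.
pose i0 := [arg max_(k > i) `|tnth c k|]%O.
have i0max k : `|tnth c k| <= `|tnth c i0| by rewrite /i0; case: arg_maxP => // l _; exact.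
have i00 : tnth c i0 != 0 by rewrite -normr_gt0; apply: lt_le_trans (i0max i); rewrite normr_gt0.
pose H n := [set y : pt | dotp c y + b = 0 /\ forall i, `|tnth y i| <= n%:R].
have -> : [set y : pt | dotp c y + b = 0] = \bigcup_n H n.
  apply/seteqP; split => [y Hy|y [n _ []] //].
  exists (Num.truncn (\sum_k `|tnth y k|)).+1 => //; split => // k.
  apply: le_trans (ltW (truncnS_gt _)).
  by rewrite (bigD1 k) //= lerDl sumr_ge0.
apply: negligible_bigcup => n.
have mH : measurable (H n).
  have -> : H n = ((fun y : pt => dotp c y + b) @^-1` [set 0]) `&`
     \bigcap_(i in [set: 'I_d]) ((fun y : pt => tnth y i) @^-1` `[- n%:R, n%:R]).
    apply/seteqP; split => y /= [Hy yn]; split => // k.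
      by move=> _ /=; rewrite in_itv /= -ler_norml.
    by have := yn k I; rewrite /= in_itv /= -ler_norml.
  apply: measurableI.
    by rewrite -[X in measurable X]setTI; apply: measurable_affine => //; exact: measurable_set1.
  apply: fin_bigcap_measurable => // k _.
  by rewrite -[X in measurable X]setTI; apply: measurable_tnth => //; exact: measurable_itv.
apply/negligibleP => //; apply: ac => //; exact: bounded_hyperplane_null i00 i0max.
Qed.
End Hyperplanes.

Local Close Scope classical_set_scope.

(** * Configurations of slabs and power diagrams *)

Import numFieldNormedType.Exports.

Local Open Scope classical_set_scope.

Section Configurations.
Variables (R : realType) (d q N t : nat) (v0 : 'I_d).
Local Notation G := 'I_q.+2.
Local Notation X := 'M[R]_(N.+1, q.+2).
Local Notation pt := (pt R d).
Implicit Types (x : X) (y : pt) (l k c : nat) (s : G).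

(** Each slab owns d + 1 consecutive rows, the last for the constant terms. When N + 1 = t (d + 1),
    [inord] does not truncate for [l < t] and [c <= d]. *)
Definition coord x l c s : R := x (inord (l * d.+1 + c)) s.

Definition slope x l s : pt := [tuple coord x l c s | c < d].

Definition offset x l s : R := coord x l d s.

Definition functional x l s y : R := dotp (slope x l s) y + offset x l s.

Definition gap x l s s' : R := \sum_(c < d.+1) `|coord x l c s - coord x l c s'|.

Definition total_gap x l : R := \sum_s \sum_s' gap x l s s'.

(** Chosen so that 2 p^4 delta = 1 / ((N + 1) p), the mean entry of a point of the domain. *)
Definition delta : R := (2 * N.+1%:R * q.+2%:R ^+ 5)^-1.

(* Slab [l] is empty when its functionals are too close to each other for their differences to be
   controlled. *)
Definition weight x l : R := Num.max 0 (total_gap x l - q.+2%:R ^+ 4 * delta).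

Definition cut x k : R := \sum_(l < k) weight x l.

(* A decreasing function of the coordinate [v0] with values in ]0, 1[; every unbounded slab is then
   also described by two inequalities. *)
Definition height y : R := 2^-1 - atan (tnth y v0) / pi.

Definition slab x l y : Prop := cut x l < height y * cut x t < cut x l.+1.

Definition cell x s : set pt :=
  [set y | exists2 l, (l < t)%N &
    slab x l y /\ forall s', s' != s -> functional x l s' y < functional x l s y].

Definition good x : Prop := 0 < cut x t /\
  forall l, (l < t)%N -> 0 < weight x l -> forall s s', s != s' -> 0 < gap x l s s'.

Lemma weight_ge0 x l : 0 <= weight x l.
Proof. by rewrite le_max lexx. Qed.

Lemma cutS x k : cut x k.+1 = cut x k + weight x k.
Proof. by rewrite /cut big_ord_recr. Qed.

Lemma le_cut x k l : (k <= l)%N -> cut x k <= cut x l.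
Proof.
move=> /subnKC <-; elim: (l - k)%N => [|n IH]; first by rewrite addn0.
by rewrite addnS cutS (le_trans IH) // lerDl weight_ge0.
Qed.

Lemma cut0 x : cut x 0 = 0. Proof. by rewrite /cut big_ord0. Qed.

Lemma height_bounds y : 0 < height y < 1.
Proof.
have p0 := pi_gt0 R; have hl := atan_gtNpi2 (tnth y v0); have hr := atan_ltpi2 (tnth y v0).
have : - 2^-1 < atan (tnth y v0) / pi < 2^-1.
  by rewrite ltr_pdivlMr // ltr_pdivrMr //; apply/andP; split; lra.
by rewrite /height; lra.
Qed.

Lemma gap_sym x l s s' : gap x l s s' = gap x l s' s.
Proof. by apply: eq_bigr => c _; rewrite distrC. Qed.

Lemma gap_ge0 x l s s' : 0 <= gap x l s s'.
Proof. exact: sumr_ge0. Qed.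

Lemma gap_functional x l s s' : 0 < gap x l s s' ->
  (exists i, tnth (slope x l s) i - tnth (slope x l s') i != 0) \/
  offset x l s - offset x l s' != 0.
Proof.
move=> gp; have [//|no] := pselect (exists i, tnth (slope x l s) i - tnth (slope x l s') i != 0).
  by left.
right; apply: contraTneq gp => oE; rewrite -leNgt /gap big_ord_recr /= big1.
  by rewrite add0r -[coord x l d s]/(offset x l s) -[coord x l d s']/(offset x l s') oE normr0.
move=> i _; have /negP/negPn/eqP : ~ (tnth (slope x l s) i - tnth (slope x l s') i != 0).
  by move=> ii; apply: no; exists i.
by rewrite !tnth_mktuple => ->; rewrite normr0.
Qed.

Lemma functionalB x l s s' y : functional x l s y - functional x l s' y =
  dotp [tuple tnth (slope x l s) i - tnth (slope x l s') i | i < d] y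
  + (offset x l s - offset x l s').
Proof.
rewrite /functional opprD addrACA; congr (_ + _); rewrite /dotp -sumrB.
by apply: eq_bigr => i _; rewrite [X in _ = X * _]tnth_mktuple mulrBl.
Qed.

(* The infinite positions are those of the heights [0] and [T]. *)
Lemma cut_position (T c : R) (v : pt) : 0 < T -> tnth v v0 = 1 ->
  (forall i, i != v0 -> tnth v i = 0) -> 0 <= c <= T ->
  exists a : \bar R,
    Hplus v a = [set y | height y * T <= c] /\ Hminus v a = [set y | c <= height y * T].
Proof.
move=> T0 v1 vi /andP[c0 cT].
have vE y : dotp y v = tnth y v0.
  rewrite /dotp (bigD1 v0) //= v1 mulr1 big1 ?addr0 // => i /vi ->; exact: mulr0.
have hT y : 0 < height y * T < T.
  by have /andP[h0 h1] := height_bounds y; rewrite mulr_gt0 //= gtr_pMl.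
have [->|c_neq0] := eqVneq c 0.
  exists +oo%E; split; apply/seteqP; split => y; rewrite /Hplus /Hminus /= ?leye_eq ?leey //.
    by have /andP[h0 _] := hT y; rewrite leNgt h0.
  by move=> _; have /andP[/ltW] := hT y.
have [->|c_neqT] := eqVneq c T.
  exists -oo%E; split; apply/seteqP; split => y; rewrite /Hplus /Hminus /= ?leeNy_eq ?leNye //.
    by move=> _; have /andP[_ /ltW] := hT y.
  by have /andP[_ h0] := hT y; rewrite leNgt h0.
have p0 := pi_gt0 R.
(* The value of [atan] at which the height is c / T. *)
pose th := pi * (2^-1 - c / T).
have cT0 : 0 < c / T < 1.
  have c_gt0 : 0 < c by rewrite lt_neqAle eq_sym c_neq0.
  by rewrite divr_gt0 //= ltr_pdivrMr // mul1r lt_neqAle c_neqT.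
have thi : th \in `](- (pi / 2)), (pi / 2)[%R by rewrite in_itv /= /th; nra.
have hE y : height y * T - c = (th - atan (tnth y v0)) / pi * T.
  have Tn : T != 0 by rewrite gt_eqF.
  have pn : pi != 0 :> R by rewrite gt_eqF.
  rewrite /height /th; move: (pi : R) (atan _) pn => P a Pn.
  by field; rewrite Tn Pn.
have thK : atan (tan th) = th by exact: tanK.
have mono z : (tan th <= z) = (th <= atan z).
  have [/le_atan|/lt_atan] := leP (tan th) z; rewrite thK; first by move->.
  by rewrite ltNge => /negPf.
have mono' z : (z <= tan th) = (atan z <= th).
  have [/le_atan|/lt_atan] := leP z (tan th); rewrite thK; first by move->.
  by rewrite ltNge => /negPf.
exists (tan th)%:E; split; apply/seteqP; split => y /=;
  rewrite /Hplus /Hminus /= lee_fin vE ?mono ?mono' => h;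
  have hTp : 0 < T / pi by rewrite divr_gt0.
- by rewrite -subr_le0 hE -mulrA [pi^-1 * _]mulrC pmulr_lle0 // subr_le0.
- by move: h; rewrite -subr_le0 hE -mulrA [pi^-1 * _]mulrC pmulr_lle0 // subr_le0.
- by rewrite -subr_ge0 hE -mulrA [pi^-1 * _]mulrC pmulr_lge0 // subr_ge0.
- by move: h; rewrite -subr_ge0 hE -mulrA [pi^-1 * _]mulrC pmulr_lge0 // subr_ge0.
Qed.
End Configurations.

Local Close Scope classical_set_scope.

Local Open Scope classical_set_scope.

Lemma negligible_exists (I : countType) (R : realType) (disp : measure_display)
  (T : measurableType disp) (mu : {measure set T -> \bar R}) (F : I -> set T) :
  (forall i, mu.-negligible (F i)) -> mu.-negligible [set y | exists i, F i y].
Proof.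
move=> nF; pose F' n := if unpickle n is Some i then F i else set0.
have -> : [set y | exists i, F i y] = \bigcup_n F' n.
  apply/seteqP; split => [y [i Fy]|y [n _]]; first by exists (pickle i) => //; rewrite /F' pickleK.
  by rewrite /F'; case: unpickle => // i Fy; exists i.
apply: negligible_bigcup => n; rewrite /F'; case: unpickle => [i|]; first exact: nF.
exact: negligible_set0.
Qed.

(** * Labelled unions of iterated partitions *)

Section LabelUnion.
Variables (R : realType) (d r : nat).
Implicit Types (P : lpart R d r) (s : 'I_r).

Lemma label_union_nil s : label_union ([::] : lpart R d r) s = set0.
Proof. by apply/seteqP; split => // x [p []]. Qed.

Lemma label_union_cons p P s :
  label_union (p :: P) s = (if p.2 == s then p.1 else set0) `|` label_union P s.
Proof.
apply/seteqP; split => x.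
  by move=> [p' [<-|inP] [<- xp]]; [left; rewrite eqxx|right; exists p'].
move=> [|[p' inP xp]]; last by exists p' => //; right.
by case: eqP => // ps xp; exists p; [left|].
Qed.

Lemma label_union_cat P1 P2 s :
  label_union (P1 ++ P2) s = label_union P1 s `|` label_union P2 s.
Proof.
elim: P1 => [|p P IH]; first by rewrite label_union_nil set0U.
by rewrite cat_cons !label_union_cons IH setUA.
Qed.

Lemma label_union_restrict (A : set (pt R d)) P s :
  label_union [seq (A `&` p.1, p.2) | p <- P] s = A `&` label_union P s.
Proof.
elim: P => [|p P IH]; first by rewrite !label_union_nil setI0.
rewrite map_cons !label_union_cons IH setIUr /=; congr (_ `|` _).
by case: ifP; rewrite ?setI0.
Qed.

Lemma label_union_star v a P1 P2 s : label_union (star v a P1 P2) s =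
  (Hplus v a `&` label_union P1 s) `|` (Hminus v a `&` label_union P2 s).
Proof. by rewrite label_union_cat !label_union_restrict. Qed.

Lemma label_union_power_diagram (c : 'I_r -> pt R d) (b : 'I_r -> R) s :
  label_union (power_diagram c b) s =
  [set x | forall j, dotp (c j) x + b j <= dotp (c s) x + b s].
Proof.
have U (e : seq 'I_r) (f : 'I_r -> set (pt R d)) : s \in e ->
    label_union [seq (f i, i) | i <- e] s = f s.
  move=> se; have H e' x : label_union [seq (f i, i) | i <- e'] s x <-> s \in e' /\ f s x.
    elim: e' => [|i e' IH]; first by rewrite label_union_nil; split => // -[].
    rewrite map_cons label_union_cons inE; split.
      by case=> [/=|/IH[-> fx]]; [case: eqP => // -> fx; rewrite eqxx|rewrite orbT].
    by case=> /predU1P[<- fx|? fx]; [left; rewrite eqxx|right; apply/IH].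
  by apply/seteqP; split => x; rewrite H; [case|].
by rewrite U // mem_enum.
Qed.

Lemma measurable_Hplus v a : measurable (@Hplus R d v a).
Proof.
case: a => [a| |].
- rewrite (_ : Hplus _ _ = (fun y => dotp v y + 0) @^-1` `[a, +oo[).
    by rewrite -[X in measurable X]setTI; apply: measurable_affine.
  apply/seteqP; split => y; rewrite /Hplus /= in_itv /= andbT lee_fin addr0 /dotp;
  by under eq_bigr do rewrite mulrC.
- by rewrite (_ : Hplus _ _ = set0) //; apply/seteqP; split => y //; rewrite /Hplus /= leye_eq.
- by rewrite (_ : Hplus _ _ = setT) //; apply/seteqP; split => y //; rewrite /Hplus /= leNye.
Qed.

Lemma measurable_Hminus v a : measurable (@Hminus R d v a).
Proof.
case: a => [a| |].
- rewrite (_ : Hminus _ _ = (fun y => dotp v y + 0) @^-1` `]-oo, a]).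
    by rewrite -[X in measurable X]setTI; apply: measurable_affine.
  apply/seteqP; split => y; rewrite /Hminus /= in_itv /= lee_fin addr0 /dotp;
  by under eq_bigr do rewrite mulrC.
- by rewrite (_ : Hminus _ _ = setT) //; apply/seteqP; split => y //; rewrite /Hminus /= leey.
- by rewrite (_ : Hminus _ _ = set0) //; apply/seteqP; split => y //; rewrite /Hminus /= leeNy_eq.
Qed.

Lemma measurable_label_union n P s : iterated n P -> measurable (label_union P s).
Proof.
elim=> [c b _|n1 n2 P1 P2 v a _ m1 _ m2 _].
  rewrite label_union_power_diagram.
  rewrite (_ : [set _ | _] = \bigcap_(j in [set: 'I_r])
      (fun x => (dotp (c j) x + b j) - (dotp (c s) x + b s)) @^-1` `]-oo, 0]).
    apply: fin_bigcap_measurable => // j _; rewrite -[X in measurable X]setTI.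
    by apply: measurable_funB => //; apply: measurable_affine.
  apply/seteqP; split => x /= H j; first by move=> _; rewrite /= in_itv /= subr_le0.
  by have := H j I; rewrite /= in_itv /= subr_le0.
rewrite label_union_star; apply: measurableU; apply: measurableI => //.
  exact: measurable_Hplus.
exact: measurable_Hminus.
Qed.

(* Leaf [l] ends up between the hyperplanes at the positions [a l] and [a l.+1]. *)
Fixpoint comb (leaf : nat -> lpart R d r) (v : pt R d) (a : nat -> \bar R) (k n : nat) : lpart R d r :=
  if n is n'.+1 then star v (a k.+1) (leaf k) (comb leaf v a k.+1 n') else leaf k.

Lemma iterated_comb leaf v a k n : unit_vec v ->
  (forall l, (k <= l <= k + n)%N -> iterated 1 (leaf l)) -> iterated n.+1 (comb leaf v a k n).
Proof.
move=> uv; elim: n k => [|n IH] k lf /=; first by apply: lf; rewrite addn0 leqnn.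
rewrite -[n.+2]add1n; apply: iterated_star => //; first by apply: lf; rewrite leqnn leq_addr.
by apply: IH => l /andP[kl ln]; apply: lf; rewrite (ltnW kl) /= -addSnnS.
Qed.

Lemma size_comb leaf v a k n : (forall l, size (leaf l) = r) ->
  size (comb leaf v a k n) = (r * n.+1)%N.
Proof.
move=> lf; elim: n k => [|n IH] k /=; first by rewrite lf muln1.
by rewrite size_cat !size_map lf IH [RHS]mulnS.
Qed.

(** Each [star] puts its leaf on the [Hplus] side, where [h] is small. The two end slabs are bounded
    on one side only, hence the guards on the inequalities. *)
Lemma comb_sub leaf v a (h : pt R d -> R) (c : nat -> R) k n s y :
  (forall i, (k < i <= k + n)%N ->
    Hplus v (a i) = [set y | h y <= c i] /\ Hminus v (a i) = [set y | c i <= h y]) ->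
  label_union (comb leaf v a k n) s y ->
  exists l, [/\ (k <= l <= k + n)%N, label_union (leaf l) s y,
    (k < l)%N -> c l <= h y & (l < k + n)%N -> h y <= c l.+1].
Proof.
elim: n k => [|n IH] k ha /=.
  by exists k; rewrite addn0 leqnn ltnn.
have kk : (k < k.+1 <= k + n.+1)%N by rewrite ltnSn addnS ltnS leq_addr.
have [hp hm] := ha k.+1 kk.
have ha' i : (k.+1 < i <= k.+1 + n)%N ->
    Hplus v (a i) = [set y | h y <= c i] /\ Hminus v (a i) = [set y | c i <= h y].
  by move=> /andP[ki ik]; apply: ha; rewrite (ltnW ki) -addSnnS.
rewrite label_union_star hp hm => -[[/= hk lk]|[/= hk yc]].
  by exists k; split; rewrite ?leqnn ?leq_addr ?ltnn.
have [l [/andP[kl ln] lfl hl hr]] := IH _ ha' yc; exists l; split => //.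
- by rewrite (ltnW kl) -addSnnS.
- by move=> _; case: (eqVneq k.+1 l) => [<- //|kl']; apply: hl; rewrite ltn_neqAle kl'.
- by rewrite -addSnnS.
Qed.

Lemma comb_sup leaf v a (h : pt R d -> R) (c : nat -> R) k n s y l :
  (forall i, (k < i <= k + n)%N ->
    Hplus v (a i) = [set y | h y <= c i] /\ Hminus v (a i) = [set y | c i <= h y]) ->
  {homo c : i j / (i <= j)%N >-> i <= j} ->
  (k <= l <= k + n)%N -> label_union (leaf l) s y -> c l <= h y <= c l.+1 ->
  label_union (comb leaf v a k n) s y.
Proof.
move=> ha cm kln ll hl; elim: n k ha kln => [|n IH] k ha /=.
  by rewrite addn0 -eqn_leq => /eqP ->.
have kk : (k < k.+1 <= k + n.+1)%N by rewrite ltnSn addnS ltnS leq_addr.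
have [hp hm] := ha k.+1 kk.
move=> /andP[kl ln]; rewrite label_union_star hp hm.
have [kl'|kl'] := eqVneq k l; first by left; rewrite kl' /=; split => //; case/andP: hl.
have kl'' : (k < l)%N by rewrite ltn_neqAle kl'.
right; split => /=; first by case/andP: hl => [hl _]; apply: le_trans hl; exact: cm.
apply: IH; last by rewrite kl'' addSnnS.
by move=> i /andP[ki ik]; apply: ha; rewrite (ltnW ki) -addSnnS.
Qed.
End LabelUnion.

Local Close Scope classical_set_scope.

Local Open Scope classical_set_scope.

(** * Cells are disjoint and fill the space up to a null set *)

Section Cells.
Variables (R : realType) (d q N t : nat) (v0 : 'I_d).
Local Notation G := 'I_q.+2.
Local Notation X := 'M[R]_(N.+1, q.+2).
Local Notation pt := (pt R d).
Local Notation cell := (cell t v0).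
Local Notation slab := (slab t v0).
Local Notation height := (height v0).
Local Notation good := (good d t).
Local Notation cut := (cut d).
Local Notation weight := (weight d).
Local Notation gap := (gap d).
Implicit Types (x : X) (y : pt) (l k c : nat) (s : G).

Lemma slab_inj x l l' y : slab x l y -> slab x l' y -> l = l'.
Proof.
wlog ll : l l' / (l < l')%N => [H sl sl'|].
  by case: (ltngtP l l') => [ll|ll|//]; [|symmetry]; apply: H.
move=> /andP[_ h1] /andP[h2 _]; have := lt_trans h2 h1.
by rewrite ltNge (le_cut d x ll).
Qed.

Lemma cell_inj x s s' y : cell x s y -> cell x s' y -> s = s'.
Proof.
move=> [l _ [sl hs]] [l' _ [sl' hs']]; rewrite -(slab_inj sl sl') in hs'.
apply/eqP; apply: contraT => ss'.
by have := lt_trans (hs s' _) (hs' s ss'); rewrite eq_sym ss' ltxx => /(_ isT).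
Qed.

(** Slab boundaries and ties between functionals. Ties count in nonempty slabs only: in an empty
    slab the functionals may coincide everywhere. *)
Definition wall x : set pt :=
  [set y | exists k, (k <= t)%N /\ height y * cut x t = cut x k] `|`
  [set y | exists lss : nat * G * G, let: (l, s, s') := lss in
    [/\ (l < t)%N, 0 < weight x l, s != s' & functional x l s y = functional x l s' y]].

Lemma slab_exists x y : 0 < cut x t ->
  (forall k, (k <= t)%N -> height y * cut x t <> cut x k) ->
  exists2 l, (l < t)%N & slab x l y.
Proof.
move=> c0 nw; have /andP[h0 h1] := height_bounds v0 y.
have H n : (n <= t)%N -> height y * cut x t < cut x n -> exists2 l, (l < n)%N & slab x l y.
  elim: n => [|n IH] nt hn.
    by move: hn; rewrite cut0 ltNge mulr_ge0 // ltW.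
  have [lt|gt|eq] := ltgtP (height y * cut x t) (cut x n).
  - by have [l ln sl] := IH (ltnW nt) lt; exists l => //; exact: leqW.
  - by exists n => //; apply/andP.
  - by case: (nw n (ltnW nt)).
by apply: H; rewrite // gtr_pMl.
Qed.

Lemma cell_exists x y : good x -> ~ wall x y -> exists s, cell x s y.
Proof.
move=> [c0 gd] nw; have [l lt sl] : exists2 l, (l < t)%N & slab x l y.
  by apply: slab_exists => // k kt e; apply: nw; left; exists k.
pose s := [arg max_(s > (ord0 : G)) functional x l s y]%O.
have smax s' : functional x l s' y <= functional x l s y.
  by rewrite /s; case: arg_maxP => // i _; exact.
have w0 : 0 < weight x l.
  by have /andP[a b] := sl; have := lt_trans a b; rewrite cutS ltrDl.
exists s; exists l => //; split => // s' ss'; rewrite lt_neqAle smax andbT.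
by apply/eqP => e; apply: nw; right; exists (l, s', s).
Qed.

Lemma measurable_functional x l s : measurable_fun setT (functional x l s : pt -> R).
Proof. exact: measurable_affine. Qed.

Lemma measurable_height : measurable_fun setT (height : pt -> R).
Proof.
apply: measurable_funB => //; apply: measurable_funM => //.
apply: (@measurableT_comp _ _ _ _ _ _ (@atan R)); last exact: measurable_tnth.
by apply: continuous_measurable_fun => z; exact: continuous_atan.
Qed.

Lemma measurable_cell x s : measurable (cell x s).
Proof.
have -> : cell x s = \bigcup_(l in [set l | (l < t)%N])
   ((fun y => height y * cut x t) @^-1` `]cut x l, cut x l.+1[ `&`
    \bigcap_(s' in [set s' | s' != s])
      (fun y => functional x l s y - functional x l s' y) @^-1` `]0, +oo[).
  apply/seteqP; split => y /=.
    move=> [l lt [sl hs]]; exists l => //; split; first by rewrite /= in_itv.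
    by move=> s' /= ss'; rewrite /= in_itv /= andbT subr_gt0 hs.
  move=> [l lt [sl hs]]; exists l => //; split; first by move: sl; rewrite /= in_itv.
  by move=> s' ss'; have := hs s' ss'; rewrite /= in_itv /= andbT subr_gt0.
apply: bigcup_measurable => l _; apply: measurableI.
  rewrite -[X in measurable X]setTI; apply: measurable_funM => //.
  exact: measurable_height.
apply: fin_bigcap_measurable => [|s' _]; first exact: finite_finset.
rewrite -[X in measurable X]setTI.
by apply: measurable_funB => //; exact: measurable_functional.
Qed.

Definition axis : pt := [tuple (i == v0)%:R | i < d].

Lemma axis_v0 : tnth axis v0 = 1. Proof. by rewrite tnth_mktuple eqxx. Qed.
Lemma axis_other i : i != v0 -> tnth axis i = 0.
Proof. by rewrite tnth_mktuple => /negPf ->. Qed.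

Lemma unit_axis : unit_vec axis.
Proof.
rewrite /unit_vec /dotp (bigD1 v0) //= axis_v0 mulr1 big1 ?addr0 // => i /axis_other ->.
by rewrite mulr0.
Qed.

Lemma wall_negligible (mu : probability pt R) x : abs_cont mu -> good x ->
  mu.-negligible (wall x).
Proof.
move=> ac [c0 gd]; apply: negligibleU.
  apply: negligible_exists => k; have [kt|kt] := leqP k t; last first.
    by apply: negligibleS (negligible_set0 mu) => y [].
  have c0t : 0 <= cut x k <= cut x t by rewrite -(cut0 d x) !le_cut.
  have [a [hp hm]] := cut_position c0 axis_v0 axis_other c0t.
  apply: (@negligibleS _ _ _ _ (Hplus axis a `&` Hminus axis a)).
    by move=> y [_ e]; rewrite hp hm /= e.
  case: a {hp hm} => [a| |]; last 2 first.
    by apply: negligibleS (negligible_set0 mu) => y []; rewrite /Hplus /= leye_eq.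
    by apply: negligibleS (negligible_set0 mu) => y [_]; rewrite /Hminus /= leeNy_eq.
  apply: negligibleS (hyperplane_null (c := axis) (b := - a) ac _).
    move=> y []; rewrite /Hplus /Hminus /= !lee_fin => h1 h2.
    have -> : dotp axis y = dotp y axis by apply: eq_bigr => i _; rewrite mulrC.
    by apply/eqP; rewrite subr_eq0 eq_le h1 h2.
  by left; exists v0; rewrite axis_v0 oner_neq0.
apply: negligible_exists => -[[l s] s'].
have [[lt w0 ss']|no] := pselect [/\ (l < t)%N, 0 < weight x l & s != s']; last first.
  by apply: negligibleS (negligible_set0 mu) => y [? ? ? ?]; apply: no.
have := gap_functional (gd l lt w0 s s' ss') => gf.
pose c : pt := [tuple tnth (slope d x l s) i - tnth (slope d x l s') i | i < d].
have nh : mu.-negligible [set y : pt | dotp c y + (offset d x l s - offset d x l s') = 0].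
  apply: hyperplane_null => //.
  by case: gf => [[i ii]|]; [left; exists i; rewrite tnth_mktuple|right].
apply: negligibleS nh => y [_ _ _ e].
by rewrite /= -functionalB e subrr.
Qed.

Lemma sum_cell (mu : probability pt R) x : abs_cont mu -> good x ->
  \sum_s fine (mu (cell x s)) = 1.
Proof.
move=> ac gd; have mc s := measurable_cell x s.
have mU : measurable (\big[setU/set0]_(s : G) cell x s).
  by apply: bigsetU_measurable => s _.
have : mu (\big[setU/set0]_(s : G) cell x s) = 1%E.
  have -> : \big[setU/set0]_(s : G) cell x s = ~` ~` (\big[setU/set0]_(s : G) cell x s).
    by rewrite setCK.
  rewrite probability_setC; last exact: measurableC.
  have /negligibleP -> : mu.-negligible (~` \big[setU/set0]_(s : G) cell x s).
  - apply: negligibleS (wall_negligible ac gd) => y /= ny; apply: contrapT => nw.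
    have [s ys] := cell_exists gd nw; apply: ny.
    by rewrite (bigD1 s) //=; left.
  - by rewrite sube0.
  - exact: measurableC.
rewrite measure_bigsetU_ord //; last first.
  by apply/trivIsetP => s s' _ _ ss'; apply/seteqP; split => // y [ys ys'];
    case/eqP: ss'; exact: cell_inj ys ys'.
move=> sum1; apply: EFin_inj; rewrite -sum1 -sumEFin; apply: eq_bigr => s _.
by rewrite fineK // fin_num_measure.
Qed.
End Cells.

Local Close Scope classical_set_scope.

Local Open Scope classical_set_scope.

Lemma cvgr_sum (R : realType) (I : Type) (r : seq I) (f : I -> nat -> R) (a : I -> R) :
  (forall i, f i m @[m --> \oo] --> a i) ->
  \sum_(i <- r) f i m @[m --> \oo] --> \sum_(i <- r) a i.
Proof.
move=> fa; elim: r => [|i r IH].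
  by rewrite big_nil; under eq_cvg do rewrite big_nil; exact: cvg_cst.
by rewrite big_cons; under eq_cvg do rewrite big_cons; apply: cvgD.
Qed.

(** * From good configurations to partitions, and semicontinuity of the masses *)

Section Limits.
Variables (R : realType) (d q N t : nat) (v0 : 'I_d).
Local Notation G := 'I_q.+2.
Local Notation X := 'M[R]_(N.+1, q.+2).
Local Notation pt := (pt R d).
Local Notation cell := (cell t v0).
Local Notation good := (good d t).
Implicit Types (x : X) (y : pt) (l k c : nat) (s : G).

Lemma equipartition_of_good (M : nat) (mu : 'I_M -> probability pt R) x :
  (0 < t)%N -> (forall j, abs_cont (mu j)) -> good x ->
  (forall j s, fine (mu j (cell x s)) = q.+2%:R^-1) ->
  exists n (P : lpart R d q.+2), iterated n P /\ size P = (q.+2 * t)%N /\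
    forall j s, mu j (label_union P s) = ((q.+2)%:R^-1 : R)%:E.
Proof.
move=> t0 ac gd eqx; have [c0 gap0] := gd.
(* A power diagram needs distinct functionals even in an empty slab; there they are replaced by
   distinct constants. *)
pose S l s := if 0 < weight d x l then slope d x l s else [tuple 0 | i < d].
pose O l s := if 0 < weight d x l then offset d x l s else (val s)%:R.
have aff_distinct l : (l < t)%N -> affine_distinct (S l) (O l).
  move=> lt s s' ss'; rewrite /S /O; case: ifP => w0; last first.
    have dot0 : dotp ([tuple 0 | i < d] : pt) [tuple 0 | i < d] = 0.
      by rewrite /dotp big1 // => i _; rewrite tnth_mktuple mul0r.
    move=> /(congr1 (fun f => f [tuple 0 | i < d])); rewrite dot0 !add0r.
    by move/eqP; rewrite eqr_nat => /eqP/val_inj e; rewrite e eqxx in ss'.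
  move=> fE; have fe y : functional x l s y - functional x l s' y = 0.
    by rewrite /functional (congr1 (fun f => f y) fE) subrr.
  have oE : offset d x l s - offset d x l s' = 0.
    have := fe [tuple 0 | i < d]; rewrite functionalB /dotp big1 ?add0r // => i _.
    by rewrite [X in _ * X]tnth_mktuple mulr0.
  case: (gap_functional (gap0 l lt w0 s s' ss')) => [[i /eqP]|]; last by rewrite oE eqxx.
  apply.
  have := fe [tuple (j == i)%:R | j < d]; rewrite functionalB oE addr0 /dotp.
  rewrite (bigD1 i) //= [X in _ * X]tnth_mktuple eqxx mulr1 [X in X + _]tnth_mktuple big1 ?addr0 //.
  by move=> j /negPf ji; rewrite [X in _ * X]tnth_mktuple ji mulr0.
pose leaf l := power_diagram (S l) (O l).
pose h y := height v0 y * cut d x t.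
have /choice[a aP] : forall k, exists a : \bar R, (k <= t)%N ->
    Hplus (axis R v0) a = [set y | h y <= cut d x k] /\
    Hminus (axis R v0) a = [set y | cut d x k <= h y].
  move=> k; have [kt|kt] := leqP k t; last by exists 0%E.
  have ckt : 0 <= cut d x k <= cut d x t by rewrite -(cut0 d x) !le_cut.
  have [a aE] := cut_position c0 (axis_v0 R v0) (@axis_other R d v0) ckt.
  by exists a.
have [t' tE] : exists t', t = t'.+1 by exists t.-1; rewrite prednK.
pose P := comb leaf (axis R v0) a 0 t'.
have itP : iterated t P.
  rewrite tE; apply: iterated_comb => [|l /andP[_ ln]]; first exact: unit_axis.
  by apply: iterated_pd; apply: aff_distinct; rewrite tE.
exists t, P; split => //; split.
  by rewrite size_comb ?tE // => l; rewrite size_map size_enum_ord.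
move=> j s; rewrite -(eqx j s).
have aP' i : (0 < i <= 0 + t')%N -> Hplus (axis R v0) (a i) = [set y | h y <= cut d x i] /\
    Hminus (axis R v0) (a i) = [set y | cut d x i <= h y].
  by rewrite add0n => /andP[_ it]; apply: aP; rewrite tE ltnW.
have sub1 : cell x s `<=` label_union P s.
  move=> y [l lt [/andP[sl1 sl2] hs]].
  apply: (@comb_sup _ _ _ _ _ _ h (cut d x) 0 t' s y l aP').
  - by move=> i k; exact: le_cut.
  - by rewrite leq0n add0n /= -ltnS -tE.
  - have w0 : 0 < weight d x l by have := lt_trans sl1 sl2; rewrite cutS ltrDl.
    rewrite label_union_power_diagram /= /S /O w0 => s'.
    by have [->//|ss'] := eqVneq s' s; exact/ltW/hs.
  - by rewrite !ltW.
(* With [sub1], the part and the cell differ only inside the wall. This includes the empty slabs,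
   which are contained in slab boundaries. *)
have sub2 : label_union P s `\` cell x s `<=` wall t v0 x.
  move=> y [yP yc]; apply: contrapT => nw; apply: yc.
  have [l [/andP[_ lt] yl hl hr]] := comb_sub aP' yP.
  have lt' : (l < t)%N by rewrite tE ltnS -(add0n t').
  have hb := height_bounds v0 y.
  have hl' : cut d x l <= h y.
    have [->|l0] := eqVneq l 0%N; last by apply: hl; rewrite lt0n.
    by rewrite cut0 /h mulr_ge0 ?(ltW c0) //; case/andP: hb => /ltW.
  have hr' : h y <= cut d x l.+1.
    have [lt''|] := ltnP l (0 + t'); first exact: hr.
    rewrite add0n => t'l; have -> : l.+1 = t by apply/eqP; rewrite eqn_leq lt' tE ltnS.
    by rewrite /h ler_piMl ?(ltW c0) //; case/andP: hb => _ /ltW.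
  have sl : slab t v0 x l y.
    apply/andP; split; rewrite lt_neqAle.
      by rewrite hl' andbT; apply/eqP => e; apply: nw; left; exists l; rewrite ltnW.
    by rewrite hr' andbT; apply/eqP => e; apply: nw; left; exists l.+1.
  have w0 : 0 < weight d x l.
    by have /andP[sl1 sl2] := sl; have := lt_trans sl1 sl2; rewrite cutS ltrDl.
  exists l => //; split => // s' ss'.
  move: yl; rewrite label_union_power_diagram /= /S /O w0 => /(_ s').
  rewrite lt_neqAle => ->; rewrite andbT; apply/eqP => e.
  by apply: nw; right; exists (l, s', s).
have mP := measurable_label_union s itP; have mC := measurable_cell t v0 x s.
have mD : measurable (label_union P s `\` cell x s) by exact: measurableD.
have -> : label_union P s = cell x s `|` (label_union P s `\` cell x s).
  by rewrite setDE setUIr setUv setIT; apply/esym/setUidPr.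
rewrite measureU0 //; last first.
  by apply/negligibleP => //; exact: negligibleS sub2 (wall_negligible v0 (ac j) gd).
by rewrite fineK // fin_num_measure.
Qed.

Variables (xs : nat -> X) (x : X).
Hypothesis xs_cvg : forall i s, xs m i s @[m --> \oo] --> x i s.

Lemma gap_cvg l s s' : gap d (xs m) l s s' @[m --> \oo] --> gap d x l s s'.
Proof. by apply: cvgr_sum => c; apply: cvg_norm; apply: cvgB; exact: xs_cvg. Qed.

Lemma weight_cvg l : weight d (xs m) l @[m --> \oo] --> weight d x l.
Proof.
have maxE z : Num.max 0 z = (z + `|z|) / 2 :> R.
  by rewrite maxr_absE add0r sub0r normrN.
rewrite /weight maxE; under eq_cvg do rewrite maxE.
have zc : total_gap d (xs m) l - q.+2%:R ^+ 4 * delta R q N @[m --> \oo] -->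
    total_gap d x l - q.+2%:R ^+ 4 * delta R q N.
  apply: cvgB; last exact: cvg_cst.
  by apply: cvgr_sum => s; apply: cvgr_sum => s'; exact: gap_cvg.
by apply: cvgM; [apply: cvgD => //; exact: cvg_norm|exact: cvg_cst].
Qed.

Lemma cut_cvg k : cut d (xs m) k @[m --> \oo] --> cut d x k.
Proof. by apply: cvgr_sum => l; exact: weight_cvg. Qed.

Lemma functional_cvg l s y : functional (xs m) l s y @[m --> \oo] --> functional x l s y.
Proof.
apply: cvgD; last exact: xs_cvg.
apply: cvgr_sum => i; apply: cvgM; last exact: cvg_cst.
by rewrite tnth_mktuple; under eq_cvg do rewrite tnth_mktuple; exact: xs_cvg.
Qed.

Lemma near_lt (f g : nat -> R) (a b : R) : f m @[m --> \oo] --> a -> g m @[m --> \oo] --> b ->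
  a < b -> \forall m \near \oo, f m < g m.
Proof.
move=> fa gb ab; near=> m; rewrite -subr_gt0; near: m.
by apply: (cvgr_gt (b - a)); [exact: cvgB|rewrite subr_gt0].
Unshelve. all: by end_near. Qed.

(** A cell is described by finitely many strict inequalities between quantities continuous in the
    configuration. *)
Lemma near_cell s y : cell x s y -> \forall m \near \oo, cell (xs m) s y.
Proof.
move=> [l lt [/andP[sl1 sl2] hs]].
have n1 : \forall m \near \oo, cut d (xs m) l < height v0 y * cut d (xs m) t.
  by apply: near_lt sl1; [exact: cut_cvg|apply: cvgM; [exact: cvg_cst|exact: cut_cvg]].
have n2 : \forall m \near \oo, height v0 y * cut d (xs m) t < cut d (xs m) l.+1.
  by apply: near_lt sl2; [apply: cvgM; [exact: cvg_cst|exact: cut_cvg]|exact: cut_cvg].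
have n3 : \forall m \near \oo, forall s', s' != s ->
    functional (xs m) l s' y < functional (xs m) l s y.
  apply: filter_forall => s'; have [->|ss'] := eqVneq s' s; first by near=> m.
  near=> m => _; near: m; apply: near_lt (hs _ ss'); exact: functional_cvg.
near=> m; exists l => //; split; last by near: m.
by apply/andP; split; near: m.
Unshelve. all: by end_near. Qed.

(** The points of the limit cell that lie in all cells from index [k] on form an increasing sequence
    of sets; by [near_cell] their union is the limit cell. *)
Lemma cell_lsc (mu : probability pt R) s (e : R) : 0 < e ->
  \forall m \near \oo, fine (mu (cell x s)) - e <= fine (mu (cell (xs m) s)).
Proof.
move=> e0; pose F k := cell x s `&` \bigcap_(m in [set m | (k <= m)%N]) cell (xs m) s.
have mF k : measurable (F k).
  apply: measurableI; first exact: measurable_cell.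
  by apply: bigcap_measurable => [|m _]; [exists k => /=|exact: measurable_cell].
have FU : \bigcup_k F k = cell x s.
  apply/seteqP; split => [y [k _ []]//|y ys].
  have [k _ hk] := near_cell ys; exists k => //; split => // m /= km; exact: hk.
have ndF : nondecreasing_seq F.
  move=> i j ij; apply/subsetPset => y [ys yi]; split => // m /= jm; apply: yi.
  exact: leq_trans jm.
have mU : measurable (\bigcup_k F k) by rewrite FU; exact: measurable_cell.
have := nondecreasing_cvg_mu (mu := mu) mF mU ndF; rewrite FU => cF.
have fcF : fine (mu (F k)) @[k --> \oo] --> fine (mu (cell x s)).
  by apply: fine_cvg; rewrite fineK // fin_num_measure //; exact: measurable_cell.
have := cvgr_gt _ fcF (fine (mu (cell x s)) - e); rewrite ltrBlDr ltrDl => /(_ _ e0).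
move=> [k _ hk]; exists k => // m /= km; apply: le_trans (ltW (hk m km)) _.
rewrite fine_le ?fin_num_measure //; first exact: measurable_cell.
apply: le_measure; rewrite ?inE //; first exact: measurable_cell.
by move=> y [_]; apply => /=.
Qed.
End Limits.

Local Close Scope classical_set_scope.

(** * Degenerate configurations *)

Lemma connect_homo (T : finType) (e e' : rel T) (h : T -> T) u v :
  (forall a b, e a b -> e' (h a) (h b)) -> connect e u v -> connect e' (h u) (h v).
Proof.
move=> he /connectP[p]; elim: p u => [|w p IH] u /=; first by move=> _ ->.
by move=> /andP[/he uw pw] vE; apply: connect_trans (connect1 uw) (IH _ pw vE).
Qed.

Section Levels.
Variables (R : realType) (d q N t : nat).
Local Notation G := 'I_q.+2.
Local Notation X := 'M[R]_(N.+1, q.+2).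
Local Notation gap := (gap d).
Local Notation weight := (weight d).
Local Notation cut := (cut d).
Local Notation dlt := (delta R q N).
Hypothesis NE : N.+1 = (t * d.+1)%N.
Hypothesis p_pr : prime q.+2.
Implicit Types (x y : X) (l k c : nat) (s : G).

(* [threshold k] decreases in [k]: at the least [k] such that the functionals form at most [k]
   clusters at scale [threshold k], they form exactly [k] clusters, and those are stable under
   perturbations of size [delta]. *)
Definition threshold k : R := (q.+3 - k)%:R * dlt.

Definition close_rel x l k : rel G := [rel s s' | gap x l s s' <= threshold k].

Definition low x l k : bool := (#|blocks (close_rel x l k)| <= k)%N.

Lemma low_top x l : low x l q.+2.
Proof. by apply: leq_trans (leq_imset_card _ _) _; rewrite card_ord. Qed.

Definition level x l : nat := ex_minn (ex_intro (fun k => low x l k) q.+2 (low_top x l)).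

Lemma level_low x l : low x l (level x l).
Proof. by rewrite /level; case: ex_minnP. Qed.

Lemma level_min x l k : low x l k -> (level x l <= k)%N.
Proof. by rewrite /level; case: ex_minnP => m _; apply. Qed.

Lemma level_gt0 x l : (0 < level x l)%N.
Proof. exact: leq_trans (card_blocks_gt0 _ (ord0 : G)) (level_low x l). Qed.

Lemma close_rel_sym x l k : symmetric (close_rel x l k).
Proof. by move=> s s'; rewrite /close_rel /= gap_sym. Qed.

Lemma delta_gt0 : 0 < dlt.
Proof. by rewrite invr_gt0 !mulr_gt0 ?exprn_gt0 ?ltr0n. Qed.

Lemma gap_triangle x l s s' s'' : gap x l s s'' <= gap x l s s' + gap x l s' s''.
Proof. by rewrite -big_split; apply: ler_sum => c _; exact: ler_distD. Qed.

Lemma connect_gap x l k s s' : connect (close_rel x l k) s s' ->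
  gap x l s s' <= q.+2%:R * threshold k.
Proof.
move=> /connectP[p0 pp ->]; case: (shortenP pp) => p p_path us _.
have thr0 : 0 <= threshold k by rewrite mulr_ge0 // ltW // delta_gt0.
have szp : (size p <= q.+2)%N.
  by have := uniq_leq_size us (fun u _ => mem_enum G u); rewrite /= size_enum_ord => /ltnW.
apply: (@le_trans _ _ ((size p)%:R * threshold k)); last by rewrite ler_wpM2r // ler_nat.
elim: p s p_path {us szp pp} => [|u p IH] s /=.
  by rewrite mul0r /gap big1 // => c _; rewrite subrr normr0.
move=> /andP[su up]; apply: le_trans (gap_triangle x l s u _) _.
by rewrite -natr1 mulrDl mul1r addrC lerD // IH.
Qed.

(** In a single cluster, chains of at most p steps of length p delta join any two functionals.
    Summed over the p^2 pairs this is p^4 delta, the amount subtracted in [weight]. *)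
Lemma level1_weight x l : level x l = 1%N -> weight x l = 0.
Proof.
move=> l1; apply/max_idPl; rewrite subr_le0.
have low1 : low x l 1 by rewrite -l1 level_low.
have gle s s' : gap x l s s' <= q.+2%:R * (q.+2%:R * dlt).
  have := connect_gap (connect_card_blocks1 s s' (close_rel_sym x l 1) low1).
  by rewrite /threshold subSS subn0.
apply: (@le_trans _ _ (\sum_(s : G) \sum_(s' : G) q.+2%:R * (q.+2%:R * dlt))).
  by apply: ler_sum => s _; apply: ler_sum.
rewrite !sumr_const !card_ord -mulrnA -[leLHS]mulr_natr natrM.
by rewrite le_eqVlt; apply/orP; left; apply/eqP; ring.
Qed.

(** At scale [threshold q.+1], which is 2 delta, there are more than p - 1 clusters, so each
    functional is alone in its own. *)
Lemma level_top_gap x l s s' : (q.+2 <= level x l)%N -> s != s' -> 2 * dlt < gap x l s s'.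
Proof.
move=> lt; apply: contraNT; rewrite -leNgt => gle; apply/eqP.
have nlow : ~~ low x l q.+1 by apply/negP => /level_min; rewrite leqNgt lt.
apply: (connect_card_blocksT (close_rel_sym x l q.+1)).
  by rewrite card_ord ltnNge.
by apply: connect1; rewrite /close_rel /= /threshold -[q.+3]addn2 addKn.
Qed.

(** Some entry is at least the mean 1 / ((N + 1) p), and a zero in its row turns it into a gap. *)
Lemma weight_lower_bound x : domain x ->
  exists2 l, (l < t)%N & q.+2%:R ^+ 4 * dlt <= weight x l.
Proof.
move=> [x0 x1 xz].
have p0 : 0 < q.+2%:R :> R by rewrite ltr0n.
have n0 : 0 < N.+1%:R :> R by rewrite ltr0n.
have [i [s xis]] : exists i s, (N.+1%:R * q.+2%:R)^-1 <= x i s.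
  apply: contrapT => no.
  have lt i s : x i s < (N.+1%:R * q.+2%:R)^-1.
    by rewrite ltNge; apply/negP => h; apply: no; exists i, s.
  have : \sum_(i < N.+1) \sum_(s < q.+2) x i s < \sum_(i < N.+1) \sum_(s < q.+2) (N.+1%:R * q.+2%:R)^-1.
    have hasT n : has xpredT (index_enum 'I_n.+1).
      by apply/hasP; exists ord0; rewrite ?mem_index_enum.
    by apply: ltr_sum => [|i _]; [exact: hasT|apply: ltr_sum => [|s _]; [exact: hasT|]].
  rewrite x1 !sumr_const !card_ord -mulrnA -[ltRHS]mulr_natr natrM.
  by rewrite mulrC [X in X / _]mulrC mulfV ?ltxx // mulf_neq0 // gt_eqF.
have [s' xs'] := xz i.
exists (i %/ d.+1)%N; first by rewrite ltn_divLR // -NE.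
have coordE b : coord d x (i %/ d.+1) (i %% d.+1) b = x i b.
  by rewrite /coord -divn_eq inord_val.
have gle : (N.+1%:R * q.+2%:R)^-1 <= gap x (i %/ d.+1) s s'.
  rewrite /gap (bigD1 (Ordinal (ltn_pmod i (ltn0Sn d)))) //= !coordE xs' subr0 ger0_norm //.
  by apply: le_trans xis _; rewrite lerDl sumr_ge0.
have tle : gap x (i %/ d.+1) s s' <= total_gap d x (i %/ d.+1).
  rewrite /total_gap (bigD1 s) //= (bigD1 s') //= -addrA lerDl.
  by rewrite addr_ge0 // !sumr_ge0 // => *; rewrite ?sumr_ge0 // => *; exact: gap_ge0.
have dE : q.+2%:R ^+ 4 * dlt + q.+2%:R ^+ 4 * dlt = (N.+1%:R * q.+2%:R)^-1.
  by rewrite /delta; field; rewrite !gt_eqF.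
have : q.+2%:R ^+ 4 * dlt <= Num.max 0 (total_gap d x (i %/ d.+1) - q.+2%:R ^+ 4 * dlt).
  by rewrite le_max lerBrDr dE (le_trans gle tle) orbT.
exact.
Qed.

Lemma weight_le_cut x l : (l < t)%N -> weight x l <= cut x t.
Proof.
move=> lt; apply: le_trans (le_cut d x lt); rewrite cutS lerDr.
by rewrite -(cut0 d x) le_cut.
Qed.

Definition degenerate x l : bool := (1 < level x l < q.+2)%N.

Definition regular x : Prop := domain x /\ forall l : 'I_t, ~~ degenerate x l.

(** The level is 1 or p in each slab; level 1 would make the weight vanish. *)
Lemma regular_gap x l s s' : regular x -> (l < t)%N -> 0 < weight x l -> s != s' ->
  2 * dlt < gap x l s s'.
Proof.
move=> [_ reg] lt w0; apply: level_top_gap.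
have := reg (Ordinal lt); rewrite /degenerate negb_and -!leqNgt => /orP[l1|//].
by have := level1_weight (x := x) (l := l); rewrite (_ : level x l = 1%N) ?gt_eqF //;
  [move=> /(_ erefl) w; rewrite w ltxx in w0|apply/eqP; rewrite eqn_leq l1 level_gt0].
Qed.

Lemma regular_good x : regular x -> good d t x.
Proof.
move=> reg; split=> [|l lt w0 s s' ss']; last first.
  by apply: lt_trans (regular_gap reg lt w0 ss'); rewrite mulr_gt0 // delta_gt0.
have [l lt wl] := weight_lower_bound reg.1.
apply: lt_le_trans (weight_le_cut x lt); apply: lt_le_trans wl.
by rewrite mulr_gt0 ?exprn_gt0 ?ltr0n // delta_gt0.
Qed.

Definition pole x l : {set G} := small_blocks (close_rel x l (level x l)).

(** Minimality of the level gives at least [level x l] clusters at the preceding, coarser scale,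
    hence also at the scale of the level. So their number is the level, strictly between 1 and p. *)
Lemma pole_proper x l : degenerate x l -> (0 < #|pole x l| < q.+2)%N.
Proof.
move=> /andP[l1 lq]; rewrite (small_blocks_gt0 _ (ord0 : G)) /=.
rewrite -[X in (_ < X)%N](card_ord q.+2); apply: small_blocks_proper.
- exact: close_rel_sym.
- by rewrite card_ord.
rewrite card_ord (leq_ltn_trans (level_low x l)) // andbT.
have nlow : ~~ low x l (level x l).-1.
  by apply/negP => /level_min; rewrite leqNgt prednK ?leqnn // level_gt0.
rewrite /low -ltnNge in nlow.
apply: (@leq_ltn_trans (level x l).-1); first by rewrite -ltnS prednK ?level_gt0.
apply: leq_trans nlow _; apply: leq_card_blocks; try exact: close_rel_sym.
move=> s s' /= h; apply: le_trans h _; rewrite ler_wpM2r ?(ltW delta_gt0) // ler_nat.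
by apply: leq_sub2l; exact: leq_pred.
Qed.

Lemma gap_close x y (e : R) l s s' : (forall i b, `|x i b - y i b| <= e) ->
  gap x l s s' <= gap y l s s' + 2 * d.+1%:R * e.
Proof.
move=> xy; rewrite mulrC mulrA mulr_natr -[X in _ + _ *+ X]card_ord -sumr_const -big_split /=.
apply: ler_sum => c _.
have -> : coord d x l c s - coord d x l c s' = (coord d x l c s - coord d y l c s) +
  ((coord d y l c s - coord d y l c s') + (coord d y l c s' - coord d x l c s')) by ring.
apply: le_trans (ler_normD _ _) _.
apply: le_trans (lerD (xy _ _) (ler_normD _ _)) _.
by have := xy (inord (l * d.+1 + c)) s'; rewrite distrC -/(coord d _ _ _ _) => h; lra.
Qed.

(** Consecutive thresholds differ by delta, as much as the perturbation can change a gap. So the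
    clusters of [x] and of [y] at their common level both refine those of [x] at the preceding
    scale, and counting shows that all three partitions agree. *)
Lemma pole_close x y l : degenerate x l -> level x l = level y l ->
  (forall i b, `|x i b - y i b| <= dlt / (2 * d.+1%:R)) -> pole x l = pole y l.
Proof.
move=> /andP[l1 lq] lxy xy.
pose E := close_rel x l (level x l).-1.
have thrS : threshold (level x l) + dlt = threshold (level x l).-1.
  rewrite /threshold -{2}[dlt]mul1r -mulrDl natr1; congr (_%:R * _).
  by clear - l1 lq; lia.
have c1 : connect (close_rel x l (level x l)) =2 connect E.
  apply: eq_connect_card; try exact: close_rel_sym.
    by move=> s s' /= h; apply: le_trans h _; rewrite -thrS lerDl ltW // delta_gt0.
  apply: leq_trans (level_low x l) _.
  have : ~~ low x l (level x l).-1.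
    by apply/negP => /level_min; rewrite leqNgt prednK ?leqnn // level_gt0.
  by rewrite /low -ltnNge prednK // level_gt0.
have c2 : connect (close_rel y l (level y l)) =2 connect E.
  apply: eq_connect_card; try exact: close_rel_sym.
    move=> s s' /= h; apply: le_trans (gap_close l s s' xy) _.
    rewrite -thrS mulrC divfK ?mulf_neq0 ?pnatr_eq0 // lerD2r.
    by rewrite lxy.
  apply: leq_trans (level_low y l) _; rewrite -lxy.
  have : ~~ low x l (level x l).-1.
    by apply/negP => /level_min; rewrite leqNgt prednK ?leqnn // level_gt0.
  by rewrite /low -ltnNge prednK // level_gt0.
have bE u : block (close_rel x l (level x l)) u = block (close_rel y l (level y l)) u.
  by apply/setP => v; rewrite !inE c1 c2.
by apply: eq_finset => s; apply: eq_forallb => s'; rewrite !bE.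
Qed.

(** * Equivariance under rotation of the labels *)

Section Rotation.
Variables (a : G) (x : X).

Lemma coord_rot l c s : coord d (rot a x) l c s = coord d x l c (s - a).
Proof. by rewrite /coord mxE. Qed.

Lemma gap_rot l s s' : gap (rot a x) l s s' = gap x l (s - a) (s' - a).
Proof. by apply: eq_bigr => c _; rewrite !coord_rot. Qed.

Lemma sum_subr (F : G -> R) : \sum_s F (s - a) = \sum_s F s.
Proof. by rewrite [RHS](reindex_inj (h := fun s : G => s - a)) //; exact: addIr. Qed.

Lemma weight_rot l : weight (rot a x) l = weight x l.
Proof.
apply: (congr1 (fun z => Num.max 0 (z - _))).
rewrite -[RHS]sum_subr; apply: eq_bigr => s _; rewrite -[RHS]sum_subr.
by apply: eq_bigr => s' _; exact: gap_rot.
Qed.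

Lemma cut_rot k : cut (rot a x) k = cut x k.
Proof. by apply: eq_bigr => l _; exact: weight_rot. Qed.

Lemma functional_rot l s (y : pt R d) : functional (rot a x) l s y = functional x l (s - a) y.
Proof.
rewrite /functional /offset coord_rot; congr (dotp _ _ + _).
by apply: eq_from_tnth => i; rewrite !tnth_mktuple coord_rot.
Qed.

Lemma cell_rot (v0 : 'I_d) s : cell t v0 (rot a x) s = cell t v0 x (s - a).
Proof.
rewrite /cell; apply: funext => y; apply: propext; split => -[l lt [sl hs]]; exists l => //;
  (split; first by move: sl; rewrite /slab !cut_rot).
  move=> s' ss'; have := hs (s' + a); rewrite !functional_rot addrK; apply.
  by apply: contraNneq ss' => <-; rewrite addrK.
move=> s' ss'; rewrite !functional_rot; apply: hs.
by apply: contraNneq ss' => /addIr ->.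
Qed.

Lemma block_rot l k s :
  block (close_rel (rot a x) l k) s = translate a (block (close_rel x l k) (s - a)).
Proof.
apply/setP => s'; rewrite mem_translate !inE; apply/idP/idP.
  by apply: (connect_homo (h := fun u => u - a)) => u v; rewrite /close_rel /= gap_rot.
rewrite -{2}[s](subrK a) -{2}[s'](subrK a).
by apply: (connect_homo (h := fun u => u + a)) => u v; rewrite /close_rel /= gap_rot !addrK.
Qed.

Lemma low_rot l k : low (rot a x) l k = low x l k.
Proof.
rewrite /low; congr (_ <= _)%N.
have -> : blocks (close_rel (rot a x) l k) = translate a @: blocks (close_rel x l k).
  apply/setP => B; apply/imsetP/imsetP => [[s _ ->]|[C /imsetP[s _ ->] ->]].
    by rewrite block_rot; eexists; [exact: imset_f|].
  by exists (s + a); rewrite // block_rot addrK.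
apply: card_imset => B C /setP BC; apply/setP => s.
by have := BC (s + a); rewrite !mem_translate addrK.
Qed.

Lemma level_rot l : level (rot a x) l = level x l.
Proof. by rewrite /level; apply: eq_ex_minn => k; exact: low_rot. Qed.

Lemma degenerate_rot l : degenerate (rot a x) l = degenerate x l.
Proof. by rewrite /degenerate level_rot. Qed.

Lemma pole_rot l : pole (rot a x) l = translate a (pole x l).
Proof.
apply/setP => s; rewrite mem_translate /pole level_rot !inE.
apply/forallP/forallP => H s'; last by rewrite !block_rot !card_translate; exact: H.
by have := H (s' + a); rewrite !block_rot !card_translate addrK.
Qed.
End Rotation.
End Levels.

Lemma mx_entry_norm (R : realType) (m n : nat) (x : 'M[R]_(m.+1, n.+1)) i j : `|x i j| <= `|x|.
Proof. by rewrite [leRHS]/Num.Def.normr /= mx_normrE (le_bigmax _ _ (i, j)). Qed.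

(** * The labelling and its overfull columns *)

Section Labels.
Variables (R : realType) (d q N t M : nat) (v0 : 'I_d).
Local Notation G := 'I_q.+2.
Local Notation X := 'M[R]_(N.+1, q.+2).
Local Notation dlt := (delta R q N).
Hypothesis NE : N.+1 = (t * d.+1)%N.
Hypothesis p_pr : prime q.+2.
Variable mu : 'I_M.+1 -> probability (pt R d) R.
Hypothesis ac : forall j, abs_cont (mu j).
Hypothesis no_equipartition : forall x : X, good d t x ->
  ~ forall j s, fine (mu j (cell t v0 x s)) = q.+2%:R^-1.
Implicit Types (x y : X) (l k c : nat) (s : G).

Definition mass x (j : 'I_M.+1) s : R := fine (mu j (cell t v0 x s)).

Definition maxima x j : {set G} :=
  [set s | [forall j', forall s', mass x j' s' <= mass x j s]].

(* Level [k] of slab [l] is an actual label only for [1 < k < p]. *)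
Definition J := ('I_M.+1 + 'I_t * 'I_q.+2)%type.

Definition cap (j : J) : nat :=
  match j with inl _ => q.+1 | inr (_, k) => (1 < k)%N end.

(** Degenerate slabs take precedence, so measures are compared only at regular points of the domain.
    The last branch is never reached, by [maxima_exist]. *)
Definition lab x : J * G :=
  if [pick l : 'I_t | degenerate d x l] is Some l
  then (inr (l, inord (level d x l)), mean (pole d x l))
  else if [pick j | maxima x j != finset.set0] is Some j then (inl j, select (maxima x j))
  else (inl ord0, 0).

Lemma mass_rot a x j s : mass (rot a x) j s = mass x j (s - a).
Proof. by rewrite /mass cell_rot. Qed.

Lemma maxima_rot a x j : maxima (rot a x) j = translate a (maxima x j).
Proof.
apply/setP => s; rewrite mem_translate !inE; apply: eq_forallb => j'.
apply/forallP/forallP => H s'; last by rewrite !mass_rot; exact: H.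
by have := H (s' + a); rewrite !mass_rot addrK.
Qed.

Lemma maxima_exist x : exists j, maxima x j != finset.set0.
Proof.
pose js := [arg max_(js > (ord0, ord0) : 'I_M.+1 * G) mass x js.1 js.2]%O.
exists js.1; apply/set0Pn; exists js.2; rewrite inE; apply/forallP => j; apply/forallP => s.
by rewrite /js; case: arg_maxP => // i _ /(_ (j, s)); exact.
Qed.

(** If all [s] were maxima for one measure, its masses would all be 1/p; the other masses, being at
    most 1/p, would equal it too, giving an equipartition. *)
Lemma maxima_proper x j : regular d t x -> (#|maxima x j| < q.+2)%N.
Proof.
move=> reg; have gd := regular_good NE reg.
rewrite -[X in (_ < X)%N](card_ord q.+2) ltn_neqAle max_card andbT; apply/negP => /eqP full.
have all_max s : s \in maxima x j.
  have /eqP -> : maxima x j == finset.setT by rewrite eqEcard finset.subsetT cardsT full leqnn.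
  by rewrite inE.
have le_mass j' s' s : mass x j' s' <= mass x j s.
  by have := all_max s; rewrite inE => /forallP/(_ j')/forallP/(_ s').
have p0 : q.+2%:R != 0 :> R by rewrite pnatr_eq0.
have eq_mass s : mass x j s = q.+2%:R^-1.
  have eq_s s' : mass x j s' = mass x j s by apply/le_anti; rewrite !le_mass.
  have := sum_cell v0 (ac j) gd; rewrite (eq_bigr (fun=> mass x j s)) => [|s' _]; last exact: eq_s.
  by rewrite sumr_const card_ord -[LHS]mulr_natr => e; apply: (mulIf p0); rewrite e mulVf.
apply: (no_equipartition gd) => j' s; apply/eqP; rewrite eq_le -[X in X <= _ ]/(mass x j' s).
rewrite -(eq_mass ord0) le_mass /= leNgt; apply/negP => lt.
have := sum_cell v0 (ac j') gd; apply/eqP; rewrite lt_eqF //.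
have -> : 1 = \sum_(s : G) q.+2%:R^-1 :> R by rewrite sumr_const card_ord -[RHS]mulr_natr mulVf.
rewrite (bigD1 s) //= [ltRHS](bigD1 s) //= ltr_leD //; first by rewrite -(eq_mass ord0).
by apply: ler_sum => s' _; rewrite -(eq_mass ord0) le_mass.
Qed.

Lemma regularP x : domain x -> (forall l : 'I_t, degenerate d x l = false) -> regular d t x.
Proof. by move=> xd nd; split => // l; rewrite nd. Qed.

Lemma lab_rot a x : domain x -> lab (rot a x) = shift a (lab x).
Proof.
move=> xd; rewrite /lab (eq_pick (Q := fun l : 'I_t => degenerate d x l)); last first.
  by move=> l; rewrite /= degenerate_rot.
case: pickP => [l dl|nd].
  by rewrite level_rot pole_rot /shift /= mean_shift // pole_proper.
rewrite (eq_pick (Q := fun j => maxima x j != finset.set0)); last first.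
  by move=> j; rewrite /= maxima_rot -!card_gt0 card_translate.
case: pickP => [j mj|no]; last by have [j] := maxima_exist x; rewrite no.
rewrite /shift /= maxima_rot select_translate // card_gt0 mj /=.
by apply: maxima_proper; exact: regularP.
Qed.

Lemma sum_cap : (\sum_(j : J) cap j = M.+1 * q.+1 + t * q)%N.
Proof.
rewrite big_sumType /= sum_nat_const card_ord; congr (_ + _)%N.
transitivity (\sum_(l < t) \sum_(k < q.+2) (1 < k)%N)%N.
  by rewrite pair_bigA; apply: eq_bigr => -[].
rewrite sum_nat_const card_ord; congr (_ * _)%N.
rewrite !big_ord_recl /= (eq_bigr (fun=> 1%N)) //.
by rewrite sum_nat_const card_ord muln1.
Qed.

Lemma cap_lt j : (cap j < q.+2)%N.
Proof. by case: j => //= -[_ k]; case: (1 < k)%N. Qed.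

(** A column over a slab and a level cannot be overfull, since nearby configurations of equal level
    have the same pole. So the overfull column belongs to a measure and contains all p labels. *)
Lemma close_full_family (e : R) :
  (M.+1 * q.+1 + t * q < N.+1 * q.+1)%N -> 0 < e -> e <= dlt / (2 * d.+1%:R) ->
  exists j, exists xs : G -> X, [/\ forall s, regular d t (xs s),
    forall s, s \in maxima (xs s) j & forall s s' i b, `|xs s i b - xs s' i b| <= e].
Proof.
move=> size_lt e0 e_le.
have sc : (\sum_(j : J) cap j < N.+1 * q.+1)%N by rewrite sum_cap.
have [r [rd rs]] := tucker p_pr cap_lt sc lab_rot e0.
have close x y i b : x \in r -> y \in r -> `|x i b - y i b| <= e.
  move=> xr yr; apply: le_trans (rs x y xr yr).
  by have := mx_entry_norm (x - y) i b; rewrite !mxE.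
rewrite /allowed negb_forall => /existsP[j]; rewrite -ltnNge.
have labE x : x \in r -> (exists l : 'I_t, degenerate d x l /\
      lab x = (inr (l, inord (level d x l)), mean (pole d x l))) \/
    (regular d t x /\ exists j', lab x = (inl j', select (maxima x j')) /\ maxima x j' != finset.set0).
  move=> xr; rewrite /lab; case: pickP => [l dl|nd]; first by left; exists l.
  right; split; first by apply: regularP => //; exact: rd.
  case: pickP => [j' mj|no]; first by exists j'.
  by have [j'] := maxima_exist x; rewrite no.
case: j => [j|[l k]] /= full.
  have allG : column (map lab r) (inl j) = finset.setT.
    by apply/eqP; rewrite eqEcard finset.subsetT cardsT card_ord.
  have /choice[xs xsP] : forall s, exists x, [/\ x \in r, regular d t x & s \in maxima x j].
    move=> s; have : s \in column (map lab r) (inl j) by rewrite allG inE.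
    rewrite inE => /mapP[x xr]; case: (labE x xr) => [[l [_ ->]] //|[reg [j' [-> mj]]] [-> ->]].
    by exists x; split => //; apply: select_in; rewrite card_gt0.
  exists j, xs; split => s; try by case: (xsP s).
  by move=> s' i b; apply: close; [case: (xsP s)|case: (xsP s')].
(* Columns of capacity 0 carry no label, as a degenerate slab has level at least 2. *)
exfalso; have k1 : (1 < k)%N.
  case: (ltnP 1 k) full => // k1 /card_gt0P [s]; rewrite inE => /mapP[x xr].
  case: (labE x xr) => [[l' [dl ->]] [_ kE _]|[_ [j' [-> _]]] //].
  move: dl k1 => /andP[l1 lq]; by rewrite kE inordK // leqNgt l1.
move: full; rewrite k1 => /card_gt1P [s [s' []]]; rewrite !inE => /mapP[x xr xE] /mapP[y yr yE].
case: (labE x xr) xE => [[lx [dx ->]] [lE kE ->]|[_ [j' [-> _]]] //].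
case: (labE y yr) yE => [[ly [dy ->]] [lE' kE' ->]|[_ [j' [-> _]]] //].
rewrite -lE' in dy kE' *; rewrite -lE in dx kE * => /eqP; apply; congr mean.
have /andP[_ lx_lt] := dx; have /andP[_ ly_lt] := dy.
apply: (pole_close dx).
  by have := congr1 val kE; rewrite kE' /= !inordK.
by move=> i b; apply: le_trans (close x y i b xr yr) e_le.
Qed.
End Labels.

(** * The lower bound *)

Local Open Scope classical_set_scope.

Lemma bounded_matrix_cluster (R : realType) (m n : nat) (u : nat -> 'M[R]_(m.+1, n.+1)) :
  (forall k, `|u k| <= 1) ->
  exists x : 'M[R]_(m.+1, n.+1), forall (e : R) (k0 : nat), 0 < e ->
    exists2 k, (k0 <= k)%N & forall i j, `|u k i j - x i j| < e.
Proof.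
move=> u1.
have cpt : compact [set v : 'rV[R]_(m.+1 * n.+1) | forall i, `[(-1 : R), 1]%classic (v ord0 i)].
  by apply: (@rV_compact _ _ (fun=> `[(-1 : R), 1]%classic)) => i; exact: segment_compact.
have [|v [_ clv]] := cpt (mxvec (u k) @[k --> \oo]) _.
  exists 0%N => // k _ /= i; have [a b] := mxvec_indexP i.
  by rewrite mxvecE /= in_itv /= -ler_norml (le_trans (mx_entry_norm _ _ _)).
exists (vec_mx v) => e k0 e0.
have [|w [[k kk0 <-] vw]] := clv [set mxvec (u k) | k in [set k | (k0 <= k)%N]] (ball v e) _ (nbhsx_ballx v e e0).
  by exists k0 => // k /= kk0; exists k.
exists k => // i j; have := vw.2 ord0 (mxvec_index i j).
by rewrite mxvecE mxE distrC.
Qed.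

Lemma eq_of_sum_le (R : realType) (n : nat) (f : 'I_n.+1 -> R) :
  \sum_i f i = 1 -> (forall i, f i <= n.+1%:R^-1) -> forall i, f i = n.+1%:R^-1.
Proof.
move=> f1 fle i; apply/eqP; rewrite eq_le fle /= leNgt; apply/negP => lt.
have p0 : n.+1%:R != 0 :> R by rewrite pnatr_eq0.
have : \sum_i f i < \sum_(i < n.+1) n.+1%:R^-1.
  by rewrite (bigD1 i) //= [ltRHS](bigD1 i) //= ltr_leD // ler_sum.
by rewrite f1 sumr_const card_ord -[ltRHS]mulr_natr mulVf // ltxx.
Qed.

Lemma equipart_succ (R : realType) (d t q M : nat) : (0 < d)%N -> (0 < t)%N -> prime q.+2 ->
  (M.+1 * q.+1 + t * q < t * d.+1 * q.+1)%N -> equipart_prop R d q.+2 (q.+2 * t) M.+1.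
Proof.
move=> d0 t0 p_pr size_lt mu ac; apply: contrapT => no_part.
pose v0 := Ordinal d0; pose N := (t * d.+1).-1.
have NE : N.+1 = (t * d.+1)%N by rewrite prednK // muln_gt0 t0.
have no_eq (x : 'M[R]_(N.+1, q.+2)) : good d t x ->
    ~ forall j s, fine (mu j (cell t v0 x s)) = q.+2%:R^-1.
  by move=> gd eqx; apply: no_part; exact: equipartition_of_good eqx.
pose dlt := delta R q N; have dlt0 : 0 < dlt by exact: delta_gt0.
pose D := dlt / (2 * d.+1%:R).
have D0 : 0 < D by rewrite divr_gt0 // mulr_gt0 ?ltr0n.
have size_lt' : (M.+1 * q.+1 + t * q < N.+1 * q.+1)%N by rewrite NE.
(* Full families of diameter tending to 0; a subsequence [mk] makes all their members converge to
   one [x]. *)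
have /choice[jx] : forall m : nat, exists jx : 'I_M.+1 * ('I_q.+2 -> 'M[R]_(N.+1, q.+2)),
    [/\ forall s, regular d t (jx.2 s), forall s, s \in maxima t v0 mu (jx.2 s) jx.1 &
      forall s s' i b, `|jx.2 s i b - jx.2 s' i b| <= D / m.+1%:R].
  move=> m; have [||j [xs H]] := close_full_family (e := D / m.+1%:R) NE p_pr ac no_eq size_lt'.
  - by rewrite divr_gt0 ?ltr0n.
  - by rewrite ler_pdivrMr // ler_peMr ?(ltW D0) // ler1n.
  - by exists (j, xs).
pose J m := (jx m).1; pose XS m := (jx m).2; rewrite -/J -/XS => jxP.
have regXS m s : regular d t (XS m s) by case: (jxP m) => H _ _; exact: H.
have maxXS m s : s \in maxima t v0 mu (XS m s) (J m) by case: (jxP m) => _ H _; exact: H.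
have [x xcl] := bounded_matrix_cluster (u := fun m => XS m ord0) (fun m => domain_norm (regXS m ord0).1).
have /choice[mk mkP] : forall k : nat, exists m, (k <= m)%N /\
    forall i b, `|XS m ord0 i b - x i b| < k.+1%:R^-1.
  by move=> k; have [|m km H] := xcl k.+1%:R^-1 k _; [rewrite invr_gt0|exists m].
have XS_cvg s i b : XS (mk k) s i b @[k --> \oo] --> x i b.
  have bound k : `|x i b - XS (mk k) s i b| <= (D + 1) * (k.+1%:R^-1).
    have [km close] := mkP k; have [_ _ /(_ s ord0 i b) near_xs] := jxP (mk k).
    have -> : x i b - XS (mk k) s i b =
        - ((XS (mk k) s i b - XS (mk k) ord0 i b) + (XS (mk k) ord0 i b - x i b)) by ring.
    rewrite normrN mulrDl mul1r; apply: le_trans (ler_normD _ _) (lerD _ (ltW (close i b))).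
    by apply: le_trans near_xs _; rewrite ler_pM2l // lef_pV2 ?posrE // ler_nat.
  apply/cvgrPdist_lt => e e0; near=> k.
  apply: le_lt_trans (bound k) _; rewrite -ltr_pdivlMl ?addr_gt0 // .
  near: k; have e1 : 0 < (D + 1)^-1 * e by rewrite mulr_gt0 // invr_gt0 addr_gt0.
  exact: near_infty_natSinv_lt (PosNum e1).
(* The bounds [tau] for some weight and 2 delta for the gaps hold for all regular configurations, so
   goodness passes to the limit. *)
pose tau : R := q.+2%:R ^+ 4 * dlt; have tau0 : 0 < tau by rewrite mulr_gt0 // exprn_gt0.
have near_ex (P : nat -> Prop) : (\forall k \near \oo, P k) -> exists k, P k.
  by move=> [k _ H]; exists k; exact: H (leqnn k).
have gdx : good d t x.
  split=> [|l lt w0 s s' ss']; rewrite ltNge; apply/negP => le0.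
    have [k] := near_ex _ (near_lt (cut_cvg (d := d) (k := t) (XS_cvg ord0)) (cvg_cst tau) (le_lt_trans le0 tau0)).
    apply/negP; rewrite -leNgt.
    have [l lt wl] := weight_lower_bound NE (regXS (mk k) ord0).1.
    by apply: (le_trans wl); exact: weight_le_cut.
  have n1 : \forall k \near \oo, 0 < weight d (XS (mk k) ord0) l.
    by apply: near_lt w0; [exact: cvg_cst|apply: (weight_cvg (xs := fun k => XS (mk k) ord0)); exact: XS_cvg].
  have n2 : \forall k \near \oo, gap d (XS (mk k) ord0) l s s' < 2 * dlt.
    apply: near_lt (le_lt_trans le0 (mulr_gt0 (ltr0n R 2) dlt0)); last exact: cvg_cst.
    by apply: (gap_cvg (xs := fun k => XS (mk k) ord0)); exact: XS_cvg.
  have [k [wk]] := near_ex _ (filterI n1 n2); apply/negP; rewrite -leNgt ltW //.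
  exact: regular_gap (regXS _ _) lt wk ss'.
(* Finitely many measures: one of them serves infinitely many of the families. *)
have [j frequent] : exists j, forall K, exists2 k, (K <= k)%N & J (mk k) = j.
  apply: contrapT => no.
  have /choice[K KP] : forall j, exists K, forall k, (K <= k)%N -> J (mk k) != j.
    move=> j; apply: contrapT => noK; apply: no; exists j => K; apply: contrapT => noj.
    by apply: noK; exists K => k Kk; apply/eqP => Jk; apply: noj; exists k.
  have := KP (J (mk (\max_j K j))) (\max_j K j)%N (leq_bigmax _).
  by rewrite eqxx.
pose m0 (z : 'M[R]_(N.+1, q.+2)) i s := mass t v0 mu z i s.
have sum_m z i : good d t z -> \sum_s m0 z i s = 1 by move=> gz; exact: sum_cell.
have [j' [s' big]] : exists j' s', q.+2%:R^-1 < m0 x j' s'.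
  apply: contrapT => no; apply: (no_eq x gdx) => i; apply: eq_of_sum_le; first exact: sum_m.
  by move=> s; rewrite leNgt; apply/negP => lt; apply: no; exists i, s.
pose eta := m0 x j' s' - q.+2%:R^-1; have eta0 : 0 < eta by rewrite subr_gt0.
pose e := eta / (2 * q.+2%:R); have p0 : 0 < q.+2%:R :> R by rewrite ltr0n.
have e0 : 0 < e by rewrite divr_gt0 // mulr_gt0.
have [K _ KP] : \forall k \near \oo, forall s i b, m0 x i b - e <= m0 (XS (mk k) s) i b.
  apply: filter_forall => s; apply: filter_forall => i; apply: filter_forall => b.
  exact: cell_lsc (XS_cvg s) (mu i) b e e0.
have [k Kk Jk] := frequent K; have {KP} lsc := KP k Kk.
(* As the masses of a measure sum to 1, lower semicontinuity also bounds the nearby mass of [s] by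
   its limit plus (p - 1) e. Since [s] is a maximum nearby, its limit mass is below [m0 x j' s'] by
   at most p e = eta / 2. All p masses of [j] then exceed 1/p. *)
have low s : q.+2%:R^-1 < m0 x j s.
  have mx : m0 (XS (mk k) s) j' s' <= m0 (XS (mk k) s) j s.
    by have := maxXS (mk k) s; rewrite Jk inE => /forallP/(_ j')/forallP/(_ s').
  have sumz := sum_m _ j (regular_good NE (regXS (mk k) s)).
  have sumx := sum_m _ j gdx.
  rewrite (bigD1 s) //= in sumz; rewrite (bigD1 s) //= in sumx.
  have le_sum : \sum_(b | b != s) m0 x j b <= \sum_(b | b != s) m0 (XS (mk k) s) j b + q.+1%:R * e.
    have -> : q.+1%:R * e = \sum_(b : 'I_q.+2 | b != s) e.
      by rewrite sumr_const cardC1 card_ord mulr_natl.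
    by rewrite -big_split /=; apply: ler_sum => b _; rewrite -lerBlDr.
  have eE : q.+2%:R * e = eta / 2 by rewrite /e; field; rewrite gt_eqF.
  have eE' : q.+2%:R * e = q.+1%:R * e + e by rewrite -natr1 mulrDl mul1r.
  have le_eta : m0 x j' s' - eta / 2 <= m0 x j s.
    rewrite -eE eE'; move: (q.+1%:R * e) le_sum (lsc s j' s') mx sumz sumx => Q.
    move: (m0 x j' s') (m0 x j s) (m0 _ j' s') (m0 _ j s) (\sum_(_ | _) _) (\sum_(_ | _) _).
    by move=> *; lra.
  apply: lt_le_trans le_eta; move: eta0; rewrite /eta.
  by move: (m0 x j' s') (q.+2%:R^-1) => *; lra.
have := sum_m _ j gdx; apply/eqP; rewrite gt_eqF //.
have -> : 1 = \sum_(s < q.+2) q.+2%:R^-1 :> R.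
  by rewrite sumr_const card_ord -[RHS]mulr_natr mulVf // gt_eqF.
by rewrite (bigD1 ord0) //= [ltRHS](bigD1 ord0) //= ltr_leD // ler_sum // => s _; exact: ltW.
Unshelve. all: by end_near. Qed.

Local Close Scope classical_set_scope.

(** * The upper bounds *)

Local Open Scope classical_set_scope.

(** * Uniform measures on cubes *)

Section UniformBox.
Variable R : realType.

Lemma uniform_prob_itv (a b u v : R) (ab : a < b) : u <= v ->
  (uniform_prob ab `[u, v] <= ((b - a)^-1 * (v - u))%:E)%E.
Proof.
move=> uv; rewrite /uniform_prob.
apply: (@le_trans _ _ (\int[lebesgue_measure]_(x in `[u, v]) ((b - a)^-1)%:E)%E).
  apply: ge0_le_integral => //.
  - by move=> x _; rewrite lee_fin uniform_pdf_ge0.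
  - by apply/measurable_EFinP; apply: measurable_funTS; exact: measurable_uniform_pdf.
  - move=> x _; rewrite lee_fin /uniform_pdf; case: ifP => // _.
    by rewrite invr_ge0 subr_ge0 ltW.
rewrite integral_cst //= lebesgue_measure_itv /= lte_fin EFinM.
case: ltP => _; first exact: lexx.
by rewrite mule0 -EFinM lee_fin mulr_ge0 ?invr_ge0 ?subr_ge0 // ltW.
Qed.

Lemma uniform_prob_support (a b : R) (ab : a < b) : uniform_prob ab `[a, b] = 1%E.
Proof. exact: integral_uniform_pdf1. Qed.

Lemma measurable_box d (a b : pt R d) : measurable (box a b).
Proof.
have -> : box a b = \bigcap_(i in [set: 'I_d]) ((fun y : pt R d => tnth y i) @^-1` `[tnth a i, tnth b i]).
  apply/seteqP; split => y H i; first by move=> _; rewrite /= in_itv; exact: H.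
  by have := H i I; rewrite /= in_itv.
apply: fin_bigcap_measurable => // i _; rewrite -[X in measurable X]setTI.
by apply: measurable_tnth => //; exact: measurable_itv.
Qed.

Definition cons_pt d (xy : measurableTypeR R * pt R d) : pt R d.+1 := [tuple of xy.1 :: xy.2].

Lemma measurable_cons_pt d : measurable_fun setT (@cons_pt d).
Proof. by apply: (@measurable_cons _ _ _ _ fst _ snd); [exact: measurable_fst|exact: measurable_snd]. Qed.

HB.instance Definition _ d := isMeasurableFun.Build _ _ _ _ (@cons_pt d) (@measurable_cons_pt d).

Definition tail_pt d (a : pt R d.+1) : pt R d := [tuple tnth a (lift ord0 i) | i < d].

Lemma cons_pt_box d (a b : pt R d.+1) :
  @cons_pt d @^-1` box a b = `[tnth a ord0, tnth b ord0] `*` box (tail_pt a) (tail_pt b).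
Proof.
apply/seteqP; split => -[x y]; rewrite /box /cons_pt /= in_itv /=.
  move=> H; split => [|i]; first by have := H ord0; rewrite tnth0.
  by rewrite !tnth_mktuple; have := H (lift ord0 i); rewrite tnthS.
move=> [h0 hS] i; have [j ->|->] := unliftP ord0 i; last by rewrite tnth0.
by rewrite tnthS; have := hS j; rewrite !tnth_mktuple.
Qed.

(** A product of uniform laws on intervals, built one coordinate at a time; the bound on boxes
    expresses that the density is at most w^(-d). *)
Lemma uniform_box d (lo : pt R d) (w : R) : 0 < w ->
  exists P : probability (pt R d) R,
    P (box lo [tuple tnth lo i + w | i < d]) = 1%E /\
    forall a b, (forall i, tnth a i <= tnth b i) ->
      (P (box a b) <= (w^-1 ^+ d * \prod_(i < d) (tnth b i - tnth a i))%:E)%E.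
Proof.
move=> w0; elim: d lo => [|d IH] lo.
  exists (dirac ([tuple] : pt R 0)); split.
    by rewrite /= diracE mem_set // => -[].
  by move=> a b _; rewrite big_ord0 expr0 mulr1 probability_le1 //; exact: measurable_box.
have [P [P1 Ple]] := IH (tail_pt lo).
have ab : tnth lo ord0 < tnth lo ord0 + w by rewrite ltrDl.
exists (distribution (uniform_prob ab \x P)%E (@cons_pt d)); split.
  rewrite -[LHS]/((uniform_prob ab \x P)%E (@cons_pt d @^-1` box lo _)) cons_pt_box.
  rewrite product_measure1E //; last exact: measurable_box.
  rewrite tnth_mktuple [X in (X * _)%E](uniform_prob_support ab) mul1e -P1; congr (P (box _ _)).
  by apply: eq_from_tnth => i; rewrite !tnth_mktuple.
move=> a b leab.
rewrite -[leLHS]/((uniform_prob ab \x P)%E (@cons_pt d @^-1` box a b)) cons_pt_box.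
rewrite product_measure1E //; last exact: measurable_box.
rewrite big_ord_recl exprS mulrACA EFinM lee_pmul //.
  by have := uniform_prob_itv ab (leab ord0); rewrite addrAC subrr add0r.
have := Ple (tail_pt a) (tail_pt b) => /(_ _)/le_trans; apply.
  by move=> i; rewrite !tnth_mktuple.
by rewrite lee_fin; under eq_bigr do rewrite !tnth_mktuple.
Qed.

(** The bound on boxes is summed over a covering of small total volume. *)
Lemma abs_cont_uniform d (P : probability (pt R d) R) (K : R) : 0 < K ->
  (forall a b, (forall i, tnth a i <= tnth b i) ->
     (P (box a b) <= (K * \prod_(i < d) (tnth b i - tnth a i))%:E)%E) ->
  abs_cont P.
Proof.
move=> K0 Ple A mA nullA; apply/eqP; rewrite eq_le measure_ge0 andbT.
apply/lee_addgt0Pr => e e0; rewrite add0e.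
have [a [b [leab [Asub sum_le]]]] := nullA (e / K) (divr_gt0 e0 K0).
have mB k : measurable (box (a k) (b k)) by exact: measurable_box.
have sub : (P A <= \sum_(k <oo) P (box (a k) (b k)))%E by exact: measure_sigma_subadditive.
apply: le_trans sub _.
apply: lime_le; first exact: is_cvg_nneseries.
apply: nearW => n; rewrite big_mkord.
apply: (@le_trans _ _ (\sum_(k < n) (K * \prod_(i < d) (tnth (b k) i - tnth (a k) i))%:E)%E).
  by apply: lee_sum => k _; apply: Ple => i; exact: leab.
by rewrite sumEFin lee_fin -mulr_sumr mulrC -ler_pdivlMr.
Qed.

Lemma exists_box_measure d (lo : pt R d) (w : R) : 0 < w ->
  exists2 P : probability (pt R d) R, abs_cont P & P (box lo [tuple tnth lo i + w | i < d]) = 1%E.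
Proof.
move=> w0; have [P [P1 Ple]] := uniform_box lo w0; exists P => //.
by apply: abs_cont_uniform Ple; rewrite exprn_gt0 // invr_gt0.
Qed.
End UniformBox.

Local Close Scope classical_set_scope.

Local Open Scope classical_set_scope.

(** * Obstructions to equipartition *)

Section UpperBounds.
Variable R : realType.

Lemma size_iterated d r n (P : lpart R d r) : iterated n P -> size P = (r * n)%N /\ (0 < n)%N.
Proof.
elim=> [c b _|n1 n2 P1 P2 v a _ [s1 n10] _ [s2 n20] _].
  by rewrite size_map size_enum_ord muln1.
by rewrite size_cat !size_map s1 s2 mulnDr addn_gt0 n10.
Qed.

Lemma meets_of_full_measure d r n (P : lpart R d r) (s : 'I_r) (mu : probability (pt R d) R)
  (B : set (pt R d)) (e : R) : iterated n P -> 0 < e -> mu (label_union P s) = e%:E ->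
  measurable B -> mu B = 1%E -> exists2 y, B y & label_union P s y.
Proof.
move=> itP e0 muP mB muB; apply: contrapT => no.
have mP := measurable_label_union s itP.
have : (mu (label_union P s) <= mu (~` B))%E.
  apply: le_measure; rewrite ?inE //; first exact: measurableC.
  by move=> y Py By; apply: no; exists y.
by rewrite probability_setC // muB muP subee // lee_fin leNgt e0.
Qed.

Lemma affine_zero_in_box d (c : pt R d) (b : R) (lo hi : pt R d) (y z : pt R d) :
  box lo hi y -> box lo hi z -> 0 <= dotp c y + b -> dotp c z + b <= 0 ->
  exists2 u, box lo hi u & dotp c u + b = 0.
Proof.
move=> By Bz fy fz.
have [fyz|fyz] := eqVneq (dotp c y + b) (dotp c z + b).
  by exists y => //; apply/le_anti; rewrite fy fyz fz.
have D0 : 0 < (dotp c y + b) - (dotp c z + b).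
  by rewrite subr_gt0 lt_neqAle eq_sym fyz (le_trans fz fy).
pose l := (dotp c y + b) / ((dotp c y + b) - (dotp c z + b)).
have l0 : 0 <= l by rewrite divr_ge0 // ltW.
have l1 : l <= 1 by rewrite ler_pdivrMr // mul1r lerDl oppr_ge0.
exists [tuple (1 - l) * tnth y i + l * tnth z i | i < d].
  by move=> i; have := By i; have := Bz i; rewrite tnth_mktuple; nra.
have -> : dotp c [tuple (1 - l) * tnth y i + l * tnth z i | i < d] =
    (1 - l) * dotp c y + l * dotp c z.
  rewrite /dotp !mulr_sumr -big_split; apply: eq_bigr => i _.
  by rewrite [X in _ * X]tnth_mktuple /=; ring.
have : l * ((dotp c y + b) - (dotp c z + b)) = dotp c y + b by rewrite mulfVK // gt_eqF.
by move: (dotp c y) (dotp c z) => u v; lra.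
Qed.

(* [corner d 0] is the origin and [corner d i.+1] is the basis vector number [i]. *)
Definition corner d (k : nat) : pt R d := [tuple ((val i).+1 == k)%:R | i < d].

(** Let K be the largest absolute coefficient. Inside a cube the linear form varies by at most K /
    4, so the cubes at the origin and at the corresponding basis vector give K <= K / 4 + K / 4. *)
Lemma corner_transversal d (c : pt R d) (b : R) :
  (forall k, (k <= d)%N -> exists2 u,
     box (corner d k) [tuple tnth (corner d k) i + (4 * d%:R)^-1 | i < d] u &
     dotp c u + b = 0) ->
  b = 0 /\ forall i, tnth c i = 0.
Proof.
move=> H; case: d c H => [|d] c H.
  have [u _] := H 0%N (leqnn _); rewrite /dotp big_ord0 add0r => ->.
  by split => // -[].
pose w : R := (4 * d.+1%:R)^-1.
pose i0 := [arg max_(i > (ord0 : 'I_d.+1)) `|tnth c i|]%O.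
have cmax i : `|tnth c i| <= `|tnth c i0| by rewrite /i0; case: arg_maxP => // j _; exact.
pose K := `|tnth c i0|.
have near k u : box (corner d.+1 k) [tuple tnth (corner d.+1 k) i + w | i < d.+1] u ->
    `|dotp c u - dotp c (corner d.+1 k)| <= K / 4.
  move=> Bu; rewrite /dotp -sumrB.
  apply: le_trans (ler_norm_sum _ _ _) _.
  apply: (@le_trans _ _ (\sum_(i < d.+1) K * w)).
    apply: ler_sum => i _; rewrite -mulrBr normrM ler_pM //.
    have := Bu i; rewrite [X in _ && (_ <= X)]tnth_mktuple => /andP[h1 h2].
    by rewrite ger0_norm ?subr_ge0 // lerBlDl.
  rewrite sumr_const card_ord -[leLHS]mulr_natr /w invfM.
  by rewrite !mulrA mulfVK ?lexx // pnatr_eq0.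
have [u0 /near h0 e0] := H 0%N (leq0n _).
have [u1 /near h1 e1] := H i0.+1 (ltn_ord i0).
have d0 : dotp c (corner d.+1 0) = 0.
  by rewrite /dotp big1 // => i _; rewrite tnth_mktuple mulr0.
have d1 : dotp c (corner d.+1 i0.+1) = tnth c i0.
  rewrite /dotp (bigD1 i0) //= tnth_mktuple eqxx mulr1 big1 ?addr0 // => i ii.
  by rewrite tnth_mktuple eqSS; case: eqP => [/val_inj e|_]; [rewrite e eqxx in ii|rewrite mulr0].
rewrite d0 subr0 in h0; rewrite d1 in h1.
have u0E : dotp c u0 = - b by lra.
have u1E : dotp c u1 = - b by lra.
rewrite u0E normrN in h0; rewrite u1E in h1.
have K0 : K = 0.
  apply/le_anti; rewrite normr_ge0 andbT.
  have : K <= `|b| + `|- b - tnth c i0|.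
    have -> : K = `|- b - (- b - tnth c i0)| by rewrite opprB addrC subrK.
    by apply: le_trans (ler_normB _ _) _; rewrite normrN.
  by lra.
split; first by apply/normr0_eq0/le_anti; rewrite normr_ge0 andbT; move: h0; rewrite K0; lra.
by move=> i; apply/normr0_eq0/le_anti; rewrite normr_ge0 andbT -K0.
Qed.

Lemma power_diagram_bound d r m : (0 < d)%N -> (1 < r)%N -> equipart_prop R d r r m -> (m <= d)%N.
Proof.
move=> d0 r1 eqp; rewrite leqNgt; apply/negP => dm.
have w0 : 0 < (4 * d%:R)^-1 :> R by rewrite invr_gt0 mulr_gt0 // ltr0n.
have /choice[mu muP] : forall k : 'I_m, exists P : probability (pt R d) R, abs_cont P /\
    P (box (corner d k) [tuple tnth (corner d k) i + (4 * d%:R)^-1 | i < d]) = 1%E.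
  by move=> k; have [P acP P1] := exists_box_measure (corner d k) w0; exists P.
(* With r parts the iteration has a single leaf, so the partition is a power diagram. *)
have [n [P [itP [szP muPs]]]] := eqp mu (fun k => (muP k).1).
have [szP' n0] := size_iterated itP.
have n1 : n = 1%N.
  by apply/eqP; rewrite -(eqn_pmul2l (ltnW r1)) -szP' szP muln1.
have r0 : 0 < r%:R^-1 :> R by rewrite invr_gt0 ltr0n ltnW.
pose s0 := Ordinal (ltnW r1); pose s1 := Ordinal r1.
have [c [b [affd PE]]] : exists c b, affine_distinct c b /\ P = power_diagram c b.
  case: itP n1 {szP muPs szP'} => [c b affd _|]; first by exists c, b.
  move=> n1 n2 P1 P2 v a it1 it2 _ n12.
  by have [_ ?] := size_iterated it1; have [_ ?] := size_iterated it2; lia.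
pose cc : pt R d := [tuple tnth (c s0) i - tnth (c s1) i | i < d].
have diffE y : dotp cc y + (b s0 - b s1) = (dotp (c s0) y + b s0) - (dotp (c s1) y + b s1).
  rewrite opprD addrACA; congr (_ + _); rewrite /dotp -sumrB.
  by apply: eq_bigr => i _; rewrite [X in X * _ = _]tnth_mktuple mulrBl.
have [b0 c0] : b s0 - b s1 = 0 /\ forall i, tnth cc i = 0.
  apply: corner_transversal => k kd.
  have km : (k < m)%N := leq_ltn_trans kd dm.
  have [muk Pk] := muP (Ordinal km).
  have mB := measurable_box (corner d k) [tuple tnth (corner d k) i + (4 * d%:R)^-1 | i < d].
  have [y By] := meets_of_full_measure itP r0 (muPs (Ordinal km) s0) mB Pk.
  have [z Bz] := meets_of_full_measure itP r0 (muPs (Ordinal km) s1) mB Pk.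
  rewrite PE !label_union_power_diagram /= => /(_ s0) zs /(_ s1) ys.
  by apply: (affine_zero_in_box By Bz); rewrite diffE ?subr_ge0 ?subr_le0.
apply: (affd s0 s1) => //; apply/funext => y; apply/eqP; rewrite -subr_eq0 -diffE b0 addr0.
by rewrite /dotp big1 // => i _; rewrite c0 mul0r.
Qed.

(** Each of the n leaves contributes one cut point and each of the n - 1 hyperplanes another, in
    total 2 n - 1. *)
Lemma line_cuts n (P : lpart R 1 2) : iterated n P ->
  exists2 C : seq R, (size C < 2 * n)%N & forall u v : R, u <= v ->
    (forall x, x \in C -> ~~ (u <= x <= v)) ->
    exists s, forall y : pt R 1, u <= tnth y ord0 <= v -> label_union P s y.
Proof.
elim=> [c b affd|n1 n2 P1 P2 v a _ [C1 sz1 H1] _ [C2 sz2 H2] uv].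
  pose s0 : 'I_2 := ord0; pose s1 : 'I_2 := ord_max.
  pose g := tnth (c s0) ord0 - tnth (c s1) ord0; pose h := b s0 - b s1.
  have dot1 i (y : pt R 1) : dotp (c i) y = tnth (c i) ord0 * tnth y ord0 by rewrite /dotp big_ord1.
  (* If g = 0 this is the point 0 by convention, and the difference of the functionals is
     constant. *)
  exists [:: - h / g] => // u v uv nC.
  have {nC} nC : ~~ (u <= - h / g <= v) by apply: nC; rewrite inE.
  have two (i : 'I_2) : i = s0 \/ i = s1.
    by case: i => -[|[|//]] ?; [left|right]; exact: val_inj.
  have [pos|neg] : (forall x, u <= x <= v -> 0 <= g * x + h) \/ (forall x, u <= x <= v -> g * x + h <= 0).
    have [g0|g0] := eqVneq g 0; last first.
      have gE x : g * x + h = g * (x - - h / g) by field.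
      move: nC; rewrite negb_and -!ltNge; move: (- h / g) gE => z gE.
      by have [gp|gn] := ltP 0 g => /orP[zu|zv]; [left|right|right|left] => x /andP[ux xv];
        rewrite gE; nra.
    - by have [h0|h0] := leP 0 h; [left|right] => x _; rewrite g0 mul0r add0r // ltW.
  - exists s0 => y /pos; rewrite label_union_power_diagram /= => hy j.
    rewrite !dot1 /g /h in hy *; case: (two j) => ->; lra.
  - exists s1 => y /neg; rewrite label_union_power_diagram /= => hy j.
    rewrite !dot1 /g /h in hy *; case: (two j) => ->; lra.
pose e := tnth v ord0.
have dot1 (y : pt R 1) : dotp y v = tnth y ord0 * e by rewrite /dotp big_ord1.
have ee : e * e = 1 by move: uv; rewrite /unit_vec dot1.
(* The unit vector is e = 1 or -1, so the hyperplane is the point a e. For infinite [a] the value 0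
   of [fine] only adds a harmless cut point. *)
exists (fine a * e :: C1 ++ C2).
  by rewrite /= size_cat mulnDr; lia.
move=> x z xz nC.
have n1C w : w \in C1 -> ~~ (x <= w <= z) by move=> wC; apply: nC; rewrite !inE mem_cat wC orbT.
have n2C w : w \in C2 -> ~~ (x <= w <= z) by move=> wC; apply: nC; rewrite !inE mem_cat wC !orbT.
have [s1 h1] := H1 x z xz n1C; have [s2 h2] := H2 x z xz n2C.
have [side|side] : (forall y : pt R 1, x <= tnth y ord0 <= z -> Hplus v a y) \/
    (forall y : pt R 1, x <= tnth y ord0 <= z -> Hminus v a y).
  case: a nC {n1C n2C} => [a| |] nC; last 2 first.
    by right => y _; rewrite /Hminus /= leey.
    by left => y _; rewrite /Hplus /= leNye.
  have : ~~ (x <= a * e <= z) by apply: nC; rewrite mem_head.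
  have e1 : e = 1 \/ e = -1.
    have : (e - 1) * (e + 1) == 0 by apply/eqP; rewrite -subr_sqr expr2 ee expr1n subrr.
    by rewrite mulf_eq0 subr_eq0 addr_eq0 => /orP[]/eqP; [left|right].
  rewrite negb_and -!ltNge => /orP[] side; case: e1 => e1; rewrite e1 in side *;
    [left|right|right|left] => y /andP[xy yz];
    rewrite /Hplus /Hminus /= lee_fin dot1 e1; lra.
- by exists s1 => y yx; rewrite label_union_star; left; split; [exact: side|exact: h1].
- by exists s2 => y yx; rewrite label_union_star; right; split; [exact: side|exact: h2].
Qed.

Lemma line_bound t m : (0 < t)%N -> equipart_prop R 1 2 (2 * t) m -> (m <= 2 * t - 1)%N.
Proof.
move=> t0 eqp.
pose lo (k : nat) : pt R 1 := [tuple (2 * k)%:R | i < 1].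
have /choice[mu muP] : forall k : 'I_m, exists P : probability (pt R 1) R, abs_cont P /\
    P (box (lo k) [tuple tnth (lo k) i + 1 | i < 1]) = 1%E.
  by move=> k; have [P acP P1] := exists_box_measure (lo k) (ltr01 : 0 < 1 :> R); exists P.
have [n [P [itP [szP muPs]]]] := eqp mu (fun k => (muP k).1).
have [szP' n0] := size_iterated itP.
have nt : n = t by apply/eqP; rewrite -(eqn_pmul2l (isT : 0 < 2)%N) -szP' szP.
have [C szC HC] := line_cuts itP.
suff : (m <= size C)%N by move: szC; rewrite nt; lia.
(* An interval without a cut point would lie in one labelled union, of mass 1 instead of 1/2. The
   intervals are disjoint, so [f] is injective. *)
have /choice[f fP] : forall k : 'I_m, exists i : 'I_(size C),
    ((2 * k)%:R : R) <= nth 0 C i <= (2 * k)%:R + 1.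
  move=> k; apply: contrapT => no.
  have le1 : (2 * k)%:R <= (2 * k)%:R + 1 :> R by rewrite lerDl.
  have [|s Hs] := HC _ _ le1.
    move=> x xC; apply/negP => xk; apply: no.
    have ix : (index x C < size C)%N by rewrite index_mem.
    by exists (Ordinal ix); rewrite /= nth_index.
  have [_ mu1] := muP k.
  have : (1%:E <= mu k (label_union P s))%E.
    rewrite -mu1; apply: le_measure; rewrite ?inE.
    - exact: measurable_box.
    - exact: measurable_label_union itP.
    - by move=> y By; apply: Hs; have := By ord0; rewrite !tnth_mktuple.
  rewrite muPs lee_fin; apply/negP; rewrite -ltNge invf_lt1 // ltr1n.
  by [].
rewrite -[m]card_ord -[size C]card_ord; apply: (leq_card f) => k l kl.
have := fP k; have := fP l; rewrite kl => /andP[a1 a2] /andP[b1 b2].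
have h1 := le_trans a1 b2; have h2 := le_trans b1 a2.
by move: h1 h2; rewrite !natr1 !ler_nat => h1 h2; apply: val_inj => /=; lia.
Qed.
End UpperBounds.

Local Close Scope classical_set_scope.

(** * The numerical bound and the theorem *)

Lemma ceil_bound (d t q : nat) : (0 < t)%N ->
  (t * d + t.-1 %/ q.+1)%N%:Z =
    Num.ceil (((t * d * (q.+2 - 1) + t)%:R / (q.+2 - 1)%:R - 1) : rat).
Proof.
move=> t0; symmetry; apply: ceil_def.
rewrite subn1 /=; set n := (t.-1 %/ q.+1)%N.
have q0 : 0 < q.+1%:R :> rat by rewrite ltr0n.
have -> : (t * d * q.+1 + t)%:R / q.+1%:R - 1 = (t * d)%:R + (t%:R / q.+1%:R - 1) :> rat.
  by rewrite natrD natrM mulrDl mulfK ?gt_eqF // addrA.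
(* Euclidean division of t - 1 by p - 1: with quotient n, t / (p - 1) lies in ]n, n + 1], so its
   ceiling minus 1 is n. *)
have tE : (t = n * q.+1 + (t.-1 %% q.+1).+1)%N by rewrite addnS -divn_eq prednK.
have rq : (t.-1 %% q.+1 < q.+1)%N by exact: ltn_pmod.
have lo : (n%:R < t%:R / q.+1%:R :> rat).
  rewrite ltr_pdivlMr // -natrM ltr_nat; clear - tE; lia.
have hi : (t%:R / q.+1%:R <= n%:R + 1 :> rat).
  rewrite ler_pdivrMr // mulrDl mul1r -natrM -natrD ler_nat; clear - tE rq; lia.
rewrite intrB mulr1z -!pmulrn natrD.
move: ((t * d)%:R : rat) (n%:R : rat) (t%:R / _ : rat) lo hi => x y z; lra.
Qed.

Lemma equipart_lower_bound (R : realType) (d t q m : nat) : (0 < d)%N -> (0 < t)%N -> prime q.+2 ->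
  (0 < m)%N -> (m * q.+1 + t * q < t * d.+1 * q.+1)%N -> equipart_prop R d q.+2 (q.+2 * t) m.
Proof. by case: m => // m d0 t0 p_pr _; exact: equipart_succ. Qed.

Unset Implicit Arguments.
Local Close Scope ring_scope.

Theorem theorem1 (R : realType) :
  (forall d t r : nat, (1 <= d)%N -> (1 <= t)%N -> prime r ->
     exists M : nat,
       (M%:Z = Num.ceil (((t * d * (r - 1) + t)%:R / (r - 1)%:R - 1) : rat))%R /\
       equipart_prop R d r (r * t) M) /\
  (forall d r : nat, (1 <= d)%N -> prime r ->
     is_largest (equipart_prop R d r r) d) /\
  (forall t : nat, (1 <= t)%N ->
     is_largest (equipart_prop R 1 2 (2 * t)) (2 * t - 1)).
Proof.
split; last split.
- move=> d t [|[|q]] // d0 t0 p_pr; exists (t * d + t.-1 %/ q.+1); split; first exact: ceil_bound.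
  apply: equipart_lower_bound => //; first by rewrite addn_gt0 muln_gt0 t0 d0.
  (* The quotient times p - 1 is at most t - 1, which makes the dimension inequality strict. *)
  have := leq_trunc_div t.-1 q.+1.
  rewrite [(t * d.+1)%N]mulnS !mulnDl [(t * q.+1)%N]mulnS.
  by move: (t * d * q.+1)%N (t.-1 %/ q.+1 * q.+1)%N (t * q)%N; lia.
- move=> d [|[|q]] // d0 p_pr; split; last by move=> m; exact: power_diagram_bound.
  rewrite -{2}[q.+2]muln1; apply: equipart_lower_bound => //.
  by rewrite !mul1n mulSn; lia.
- move=> t t0; split; last by move=> m; exact: line_bound.
  by apply: equipart_lower_bound => //; lia.
Qed.
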